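(* Let $p$ be a prime, let $n\ge 2$, and let $G$ be a finite GGS-group acting on the $p^n$-adic tree that belongs to the class $\mathcal{E}$ defined in the context. Then for every integer $k\ge 1$ the group $G/\mathrm{St}_G(k)$ is not a Beauville group.
   Context: **Trees and GGS-groups.** Let $T$ be the rooted $p^n$-adic tree, with vertices the words over $A=\{1,\dots,p^n\}$; automorphisms act on the right. $\mathrm{St}_{\mathrm{Aut}(T)}(k)$ is the pointwise stabiliser of all vertices of level $k$, and $\mathrm{St}_G(k)=G\cap \mathrm{St}_{\mathrm{Aut}(T)}(k)$ for $G\le\mathrm{Aut}(T)$. For $f\in\mathrm{Aut}(T)$ and a vertex $u$, the section $f_u\in\mathrm{Aut}(T)$ is defined by $(uv)^f=u^f v^{f_u}$ for all words $v$. The isomorphism $\psi:\mathrm{St}_{\mathrm{Aut}(T)}(1)\to \mathrm{Aut}(T)\times\overset{p^n}{\cdots}\times\mathrm{Aut}(T)$ sends $g$ to the tuple of its first-level sections. Given a non-zero vector $\mathbf{e}=(e_1,\dots,e_{p^n-1})\in(\mathbb{Z}/p^n\mathbb{Z})^{p^n-1}$, the GGS-group with defining vector $\mathbf e$ is $G=\langle a,b\rangle\le\mathrm{Aut}(T)$, where $a$ is the rooted automorphism permuting the first-level subtrees rigidly according to the cycle $(1\,2\,\cdots\,p^n)$, and $b\in \mathrm{St}_{\mathrm{Aut}(T)}(1)$ is defined recursively by $\psi(b)=(a^{e_1},\dots,a^{e_{p^n-1}},b)$. **The numbers $R_j$.** $R_0$ is the largest integer ($\le n$) such that $p^{R_0}\mid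 e_\ell$ for all $\ell\in\{1,\dots,p^n-1\}$; for $j\ge 0$, while $R_j<n$, $R_{j+1}$ is the largest integer ($\le n$) such that $p^{R_{j+1}}\mid e_\ell$ for all $\ell\in\{p^{R_j},2p^{R_j},\dots,p^n-p^{R_j}\}$. **The numbers $S[k]$.** For $k\in\{0,\dots,n-1\}$, $S[k]=e_{p^k}+e_{2p^k}+\cdots+e_{p^n-p^k}$. (A GGS-group is periodic, i.e. torsion, if and only if $S[k]\equiv 0 \pmod{p^{k+1}}$ for all $k\in\{0,\dots,n-1\}$; in particular this holds for finite GGS-groups.) **The numbers $m_{0,0}$ and $t_k$.** For $G$ periodic: if $p^n\mid S[0]$, set $m_{0,0}=0$ and $t_0=n$. If $p^n\nmid S[0]$, then $m_{0,0}$, with $1\le m_{0,0}<n$, and $t_0,\dots,t_{m_{0,0}}\in\mathbb{N}$ are such that: $t_k<n\le t_{m_{0,0}}$ for all $k<m_{0,0}$; $p^{t_0}\mid S[0]$ and $p^{t_0+1}\nmid S[0]$; $p^{t_k}\mid S[t_{k-1}]$ and $p^{t_k+1}\nmid S[t_{k-1}]$ for $1\le k<m_{0,0}$; and $p^{t_{m_{0,0}}}\mid S[t_{m_{0,0}-1}]$. **The class $\mathcal{E}$.** $\mathcal{E}$ is the class of finite GGS-groups consisting of: (i) the GGS-groups acting on the $p^n$-adic tree, for $p$ any prime and $n\ge 2$, with $t_0=R_0$, $\dots$, $t_{m_{0,0}-1}=R_{m_{0,0}-1}$ and $R_{m_{0,0}}=n$; and (ii) the GGS-groups acting on the $2^n$-adic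 tree (so $p=2$, $n\ge2$) with $R_0=n-1$, $S[0]\equiv 0\pmod{2^n}$ and $e_{2^{n-1}}=0$. **Beauville groups.** For a finite group $H$ and $x,y\in H$ let $\Sigma(x,y)=\bigcup_{h\in H}\big(\langle x\rangle^h\cup\langle y\rangle^h\cup\langle xy\rangle^h\big)$. A finite group $H$ is a Beauville group if it is $2$-generated and there are generating sets $\{x_1,y_1\}$, $\{x_2,y_2\}$ of $H$ such that $\Sigma(x_1,y_1)\cap\Sigma(x_2,y_2)=\{1\}$. *)

(* Defs.v *)
From HB Require Import structures.
From mathcomp Require Import all_boot all_order all_algebra all_fingroup.
From mathcomp Require Import boolp classical_sets functions cardinality.

Set Implicit Arguments.
Unset Strict Implicit.
Unset Printing Implicit Defensive.

Import GRing.Theory.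

Local Open Scope group_scope.

(* The vertices are the words over [A], the root is the empty word, and the
   children of [u] are the words [rcons u x].  An automorphism is a bijection
   (with inverse [bwd]) fixing the root and mapping children of [u] to children
   of the image of [u]. *)
Record tree_aut (A : Type) := TreeAut {
  fwd :> seq A -> seq A;
  bwd : seq A -> seq A;
  fwdK : cancel fwd bwd;
  bwdK : cancel bwd fwd;
  fwd_root : fwd [::] = [::];
  fwd_child : forall u x, exists y, fwd (rcons u x) = rcons (fwd u) y }.

Section TreeAutGroup.
Variable A : Type.
Implicit Types f g h : tree_aut A.

Lemma tree_aut_ext f g : fwd f =1 fwd g -> f = g.
Proof.
move=> fg.
have fwd_fg : fwd f = fwd g by exact/funext.
have bwd_fg : bwd f = bwd g.
  by apply/funext => u; rewrite -[u in LHS](bwdK g) -fg fwdK.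
case: f g {fg} fwd_fg bwd_fg => [f1 f2 fK1 fK2 f0 fc] [g1 g2 gK1 gK2 g0 gc] /= E1 E2.
by subst g1 g2; congr TreeAut; exact: Prop_irrelevance.
Qed.

Definition tree_one : tree_aut A.
Proof.
by exists id id => // u x; exists x.
Defined.

(* Automorphisms act on the right: the image of [u] under the product [f * g]
   is the image under [g] of the image of [u] under [f]. *)
Definition tree_mul f g : tree_aut A.
Proof.
exists (fun u => g (f u)) (fun u => bwd f (bwd g u)).
- by move=> u; rewrite !fwdK.
- by move=> u; rewrite !bwdK.
- by rewrite !fwd_root.
- move=> u x; have [y ->] := fwd_child f u x.
  exact: fwd_child.
Defined.

Definition tree_inv f : tree_aut A.
Proof.
exists (bwd f) (fwd f).
- exact: bwdK.
- exact: fwdK.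
- by rewrite -[X in bwd f X](fwd_root f) fwdK.
- move=> u x; case/lastP E : (bwd f (rcons u x)) => [|w y].
    by move: (bwdK f (rcons u x)); rewrite E fwd_root; case: u {E}.
  have [z fz] := fwd_child f w y; exists y; congr rcons.
  have : rcons u x = rcons (f w) z by rewrite -fz -E bwdK.
  by case/rcons_inj => -> _; rewrite fwdK.
Defined.

HB.instance Definition _ := gen_eqMixin (tree_aut A).
HB.instance Definition _ := gen_choiceMixin (tree_aut A).

Let tree_mulA : associative tree_mul.
Proof. by move=> f g h; exact: tree_aut_ext. Qed.
Let tree_mul1 : left_id tree_one tree_mul.
Proof. by move=> f; exact: tree_aut_ext. Qed.
Let tree_mulr1 : right_id tree_one tree_mul.
Proof. by move=> f; exact: tree_aut_ext. Qed.
Let tree_mulV : left_inverse tree_one tree_inv tree_mul.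
Proof. by move=> f; apply: tree_aut_ext => u /=; rewrite bwdK. Qed.
Let tree_mulrV : right_inverse tree_one tree_inv tree_mul.
Proof. by move=> f; apply: tree_aut_ext => u /=; rewrite fwdK. Qed.

HB.instance Definition _ := isGroup.Build (tree_aut A)
  tree_mulA tree_mul1 tree_mulr1 tree_mulV tree_mulrV.

Definition level_stab (k : nat) : set (tree_aut A) :=
  [set f | forall u : seq A, size u = k -> f u = u]%classic.

End TreeAutGroup.

Definition generated (gT : groupType) (X : set gT) : set gT :=
  smallest (fun H : set gT => group_closed [pred x | x \in H]) X.

Lemma generated_group_closed (gT : groupType) (X : set gT) :
  group_closed [pred x | x \in generated X].
Proof.
split=> [|x y /=]; rewrite !inE.
  by move=> H [[H1 _] _]; move: H1; rewrite !inE.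
move=> Gx Gy H [[H1 HV] XH].
have := HV x y; rewrite !inE; apply; [exact: Gx | exact: Gy].
Qed.

(* The letters 1, ..., p^n are represented by 0, ..., p^n - 1 in ['I_(p ^ n)],
   so that the letter [x] carries the label [x.+1]. *)

Section GGS.
Variables p n : nat.

Notation letter := 'I_(p ^ n).

Definition defining_vector := 'rV['Z_(p ^ n)]_(p ^ n).-1.

Implicit Types e : defining_vector.

(* The entry e_l for a label 1 <= l <= p^n - 1. *)
Definition entry e (l : nat) : 'Z_(p ^ n) :=
  if insub l.-1 is Some i then e ord0 i else 0%R.

Definition rooted_fun (s : letter -> letter) (u : seq letter) : seq letter :=
  if u is x :: v then s x :: v else [::].

Definition ggs_a : tree_aut letter.
Proof.
exists (rooted_fun (@ordS (p ^ n))) (rooted_fun (@ord_pred (p ^ n))) => //.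
- by case=> //= x v; rewrite ordSK.
- by case=> //= x v; rewrite ord_predK.
- by case=> [|z u] x; [exists (ordS x) | exists x].
Defined.

Section Directed.
Variable e : defining_vector.

(* The section of [b] at the letter labelled [l] is [a ^+ e_l] when [l < p^n],
   and [b] itself when [l = p^n]. *)
Fixpoint b_fun (u : seq letter) : seq letter :=
  if u is x :: v then
    x :: (if x.+1 == (p ^ n)%N then b_fun v else (ggs_a ^+ entry e x.+1) v)
  else [::].

Fixpoint b_inv_fun (u : seq letter) : seq letter :=
  if u is x :: v then
    x :: (if x.+1 == (p ^ n)%N then b_inv_fun v
          else bwd (ggs_a ^+ entry e x.+1) v)
  else [::].

Definition ggs_b : tree_aut letter.
Proof.
exists b_fun b_inv_fun => //.
- elim=> //= x v IHv; case: (_ == _); first by rewrite IHv.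
  by rewrite fwdK.
- elim=> //= x v IHv; case: (_ == _); first by rewrite IHv.
  by rewrite bwdK.
- elim=> [|z u IHu] x /=.
    exists x; congr cons.
    by case: ifP => // _; rewrite fwd_root.
  case: ifP => _.
    by have [y ->] := IHu x; exists y.
  by have [y ->] := fwd_child (ggs_a ^+ entry e z.+1) u x; exists y.
Defined.

Definition ggs : set (tree_aut letter) := generated [set ggs_a; ggs_b]%classic.

End Directed.

(* Divisibility of an element of Z/p^n by p^r, in the ring Z/p^n. *)
Definition pdvd (r : nat) (x : 'Z_(p ^ n)) : bool :=
  [exists c : 'Z_(p ^ n), x == ((p ^ r)%:R * c)%R].

(* The largest r <= n such that p^r divides e_l for all the multiples l of p^c
   with 1 <= l <= p^n - 1. *)
Definition common_val e (c : nat) : nat :=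
  \max_(r < n.+1 |
     [forall l : letter, (0 < l)%N && (p ^ c %| l)%N ==> pdvd r (entry e l)]) r.

(* [Rseq e j] is the number R_j; it remains equal to n once it reaches n. *)
Fixpoint Rseq e (j : nat) : nat :=
  common_val e (if j is j'.+1 then Rseq e j' else 0).

Definition Ssum e (k : nat) : 'Z_(p ^ n) :=
  (\sum_(1 <= l < p ^ n | (p ^ k %| l)%N) entry e l)%R.

(* [m] is m_{0,0} and t_k is [t k] for k <= m; the other values of [t] are
   irrelevant. *)
Definition mt_spec e (m : nat) (t : nat -> nat) : Prop :=
  if pdvd n (Ssum e 0) then m = 0 /\ t 0 = n
  else
    [/\ (1 <= m < n)%N,
        (forall k, (k < m)%N -> (t k < n)%N) /\ (n <= t m)%N,
        pdvd (t 0) (Ssum e 0) && ~~ pdvd (t 0).+1 (Ssum e 0),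
        forall k, (1 <= k < m)%N ->
          pdvd (t k) (Ssum e (t k.-1)) && ~~ pdvd (t k).+1 (Ssum e (t k.-1)) &
        pdvd (t m) (Ssum e (t m.-1))].

Definition class_E_i e : Prop :=
  exists (m : nat) (t : nat -> nat),
    [/\ mt_spec e m t,
        forall k, (k < m)%N -> t k = Rseq e k &
        Rseq e m = n].

Definition class_E_ii e : Prop :=
  [/\ p = 2%N, Rseq e 0 = n.-1, Ssum e 0 = 0%R & entry e (2 ^ n.-1) = 0%R].

(* Membership in E of a finite GGS-group on the p^n-adic tree, p prime, n >= 2. *)
Definition class_E e : Prop := class_E_i e \/ class_E_ii e.

End GGS.

Section FiniteGGS.
Variables (p n : nat) (e : defining_vector p n) (fin_ggs : finite_set (ggs e)).

(* The finiteness proof is a parameter of the type so that the [finGroupType]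
   instance can be found from the type alone. *)
Definition ggs_type of finite_set (ggs e) : Type :=
  {g : tree_aut 'I_(p ^ n) | g \in [pred x | x \in ggs e]}.

Local Notation G := (ggs_type fin_ggs).

HB.instance Definition _ := SubChoice.on G.
HB.instance Definition _ :=
  SubChoice_isSubGroup.Build _ _ G (@generated_group_closed _ _).

Lemma ggs_enum_subproof : exists s : seq G, forall g, g \in s.
Proof.
have /finite_seqP[s Es] := fin_ggs.
exists (pmap insub s) => g; rewrite mem_pmap_sub /=.
have [Gg _] : (ggs e `<=` [set` s] /\ [set` s] `<=` ggs e)%classic by split; rewrite Es.
by apply: Gg; have := valP g; rewrite !inE.
Qed.

Definition ggs_enum : seq G := undup (projT1 (cid ggs_enum_subproof)).

Lemma mem_ggs_enum (g : G) : g \in ggs_enum.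
Proof. by rewrite mem_undup; case: cid. Qed.

Lemma ggs_pickleK :
  pcancel (fun g : G => index g ggs_enum) (fun i => onth ggs_enum i).
Proof. move=> g; rewrite onthE (nth_map g) ?index_mem ?mem_ggs_enum //.
by rewrite nth_index ?mem_ggs_enum. Qed.

HB.instance Definition _ := PCanIsCountable ggs_pickleK.

Lemma ggs_enumP : Finite.axiom ggs_enum.
Proof. by move=> g; rewrite count_uniq_mem ?undup_uniq ?mem_ggs_enum. Qed.

HB.instance Definition _ := isFinite.Build G ggs_enumP.

Definition ggs_stab (k : nat) : {set G} :=
  [set g : G | `[< level_stab k (val g) >]].

Lemma ggs_stab_group_set k : group_set (ggs_stab k).
Proof.
apply/group_setP; split=> [|f g].
  by rewrite inE; apply/asboolP => u _.
rewrite !inE => fk gk u uk.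
by rewrite gmulfM /= fk ?gk.
Qed.

Canonical ggs_stab_group k := Group (ggs_stab_group_set k).

End FiniteGGS.

Section Beauville.
Variables (gT : finGroupType) (H : {group gT}).

Definition Sigma (x y : gT) : {set gT} :=
  \bigcup_(h in H) (<[x]> :^ h :|: <[y]> :^ h :|: <[x * y]> :^ h).

Definition Beauville : Prop :=
  (exists x y : gT, <<[set x; y]>> = H) /\
  (exists x1 y1 x2 y2 : gT,
    [/\ <<[set x1; y1]>> = H, <<[set x2; y2]>> = H &
        Sigma x1 y1 :&: Sigma x2 y2 = 1]).

End Beauville.

(* Main.v *)
(* If x and y generate G/St(k), then one of x, y, xy is the image of an element g
   spelled by a and b with both exponent sums prime to p.  It therefore suffices
   that any two such elements have nontrivial powers that are conjugate modulo
   St(k).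

   In case (i), g^{p^n} has sections whose exponent sum in a has p-adic valuation
   exactly t_0 = R_0 and which lie in <a^{p^{R_0}}, b>.  Raising to the power
   p^{n-R_0}, the sections on the orbit of the last letter are again of this kind,
   with R_1 in place of R_0, while the other sections are powers of a that depend
   only on the exponent sum of b.  Iterating until R_m = n, every section is
   eventually determined by the exponent sum of b, so after equalising these sums
   a common power of the two elements coincides.

   In case (ii), the first-level sections of g lie in the dihedral group of order 8
   generated by A = a^{2^{n-1}} and b, and g^{2^n} has sections in {b, b^A}.  The
   pattern of parities of A is governed by the shift-invariant subspace of F_2^{2^n}
   spanned by the shifts of e / 2^{n-1}; it contains the constant patterns, and this
   makes all the elements g^{2^n} conjugate in G once g is replaced by a power in
   which the exponent sum of a is 1 modulo 2^n. *)

Require Import Defs.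
From HB Require Import structures.
From mathcomp Require Import all_boot all_order all_algebra all_fingroup.
From mathcomp Require Import boolp classical_sets functions cardinality.
From mathcomp Require Import zify.

Set Implicit Arguments.
Unset Strict Implicit.
Unset Printing Implicit Defensive.

Local Open Scope group_scope.

(** * Equality of tree automorphisms on a level *)

Section LevelCongruence.
Variable A : Type.
Implicit Types f g h : tree_aut A.

Definition eq_level (k : nat) f g := forall u, size u = k -> f u = g u.

Lemma fwdM f g u : (f * g) u = g (f u). Proof. by []. Qed.

Lemma eq_level_refl k f : eq_level k f f.
Proof. by []. Qed.

Lemma eq_level_sym k f g : eq_level k f g -> eq_level k g f.
Proof. by move=> fg u /fg. Qed.

Lemma eq_level_trans k f g h :
  eq_level k f g -> eq_level k g h -> eq_level k f h.
Proof. by move=> fg gh u uk; rewrite fg ?gh. Qed.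

Lemma size_fwd f u : size (f u) = size u.
Proof.
elim/last_ind: u => [|u x IHu]; first by rewrite fwd_root.
by have [y ->] := fwd_child f u x; rewrite !size_rcons IHu.
Qed.

Lemma eq_levelM k f f' g g' :
  eq_level k f f' -> eq_level k g g' -> eq_level k (f * g) (f' * g').
Proof. by move=> ff gg u uk /=; rewrite ff ?gg ?size_fwd. Qed.

Lemma fwd_cat f u w : exists2 w', f (u ++ w) = f u ++ w' & size w' = size w.
Proof.
elim/last_ind: w => [|w x [w' E s]]; first by exists [::]; rewrite ?cats0.
have [y Ey] := fwd_child f (u ++ w) x.
by exists (rcons w' y); rewrite -?rcons_cat -?E -?Ey ?size_rcons ?s.
Qed.

(** Automorphisms respect prefixes: pad a word of length [j] with copies of [x0] up to length [k],
    then truncate the two images. *)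
Lemma eq_level_le (x0 : A) j k f g :
  (j <= k)%N -> eq_level k f g -> eq_level j f g.
Proof.
move=> jk fg u uj; have := fg (u ++ nseq (k - j) x0).
rewrite size_cat size_nseq uj subnKC // => /(_ erefl).
have [w -> _] := fwd_cat f u (nseq (k - j) x0).
have [w' -> _] := fwd_cat g u (nseq (k - j) x0).
by move/(congr1 (take j)); rewrite !take_cat !size_fwd uj ltnn subnn !take0 !cats0.
Qed.

End LevelCongruence.

(** * Sums of periodic functions over residues *)

Section PeriodicSums.

Lemma sum_periodic (M : nat) (F : nat -> nat) c :
  (forall x, F (x + M)%N = F x) ->
  (\sum_(j < M) F (j + c) = \sum_(j < M) F j)%N.
Proof.
move=> FM; elim: c => [|c IHc]; first by apply: eq_bigr => j _; rewrite addn0.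
rewrite -IHc; case: M FM {IHc} => [|M] FM; first by rewrite !big_ord0.
rewrite big_ord_recr big_ord_recl /= addnC; congr (_ + _)%N.
  by rewrite -(FM (0 + c)%N) add0n addnC addSn addnS.
by apply: eq_bigr => j _; rewrite /bump /= add1n addSn addnS.
Qed.

Lemma periodic_mod (M : nat) (T : Type) (F : nat -> T) :
  (forall x, F (x + M)%N = F x) -> forall x, F (x %% M)%N = F x.
Proof.
move=> FM x; rewrite {2}(divn_eq x M) addnC.
by elim: (x %/ M) => [|q IHq]; rewrite ?mul0n ?addn0 // mulSn addnCA addnC FM.
Qed.

(** Multiplication by the unit [u] permutes the residues modulo [M]. *)
Lemma sum_periodic_mul (M u : nat) (F : nat -> nat) :
  coprime u M -> (forall x, F (x + M)%N = F x) ->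
  (\sum_(j < M) F (j * u) = \sum_(j < M) F j)%N.
Proof.
case: M => [|M] cu FM; first by rewrite !big_ord0.
pose h (j : 'I_M.+1) : 'I_M.+1 := inord (j * u %% M.+1)%N.
have hE j : h j = (j * u %% M.+1)%N :> nat by rewrite inordK // ltn_pmod.
have h_inj : injective h.
  move=> i j /(congr1 val); rewrite /= !hE => /eqP.
  rewrite -[_ == _]/(_ == _ %[mod M.+1]) => eij.
  apply/val_inj => /=; wlog le_ij : i j eij / (i <= j)%N.
    move=> W; case/orP: (leq_total i j) => le_ij; first exact: W.
    by apply/esym/W; rewrite 1?eq_sym.
  move: eij; rewrite eq_sym eqn_mod_dvd ?leq_mul2r ?le_ij ?orbT //.
  rewrite -mulnBl Gauss_dvdl 1?coprime_sym //.
  have := ltn_ord j; case: (ltngtP i j) le_ij => // lt_ij _ jM /dvdn_leq; lia.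
rewrite [RHS](reindex h) /=; last exact/onW_bij/injF_bij.
by apply: eq_bigr => j _; rewrite hE (periodic_mod FM).
Qed.

End PeriodicSums.

(** * Spellings in [a] and [b] and their first-level sections *)

Section Words.
Variables p n : nat.
Hypothesis N_gt1 : (1 < p ^ n)%N.
Variable e : defining_vector p n.

Local Notation N := (p ^ n)%N.
Local Notation a := (ggs_a p n).
Local Notation b := (ggs_b e).
Local Notation aut := (tree_aut 'I_N).

Let N_gt0 : (0 < N)%N. Proof. exact: ltnW. Qed.

(* The letter with label [l], read modulo [p ^ n]. *)
Definition lab (l : nat) : 'I_N := Ordinal (ltn_pmod (l + N.-1)%N N_gt0).

(* [e_l] as a periodic function of the label.  It is 0 at the multiples of [p ^ n],
   where the section of [b] is [b] rather than a power of [a]. *)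
Definition exponent (l : nat) : nat :=
  if N %| l then 0%N else entry e (l %% N).

Local Notation E := exponent.

Lemma lab_surj (x : 'I_N) : x = lab x.+1.
Proof.
apply/val_inj; rewrite /= addSnnS prednK // modnDr modn_small //.
Qed.

Lemma lab_eq l m : (lab l == lab m) = (l == m %[mod N]).
Proof. by rewrite -val_eqE /= eqn_modDr. Qed.

Lemma lab_mod l m : l = m %[mod N] -> lab l = lab m.
Proof. by move/eqP; rewrite -lab_eq => /eqP. Qed.

Lemma exponentD l : E (l + N) = E l.
Proof. by rewrite /exponent dvdn_addl // modnDr. Qed.

Lemma exponent_mod l m : l = m %[mod N] -> E l = E m.
Proof. by move=> lm; rewrite -(periodic_mod exponentD l) lm (periodic_mod exponentD). Qed.

Lemma exponent_dvd l : N %| l -> E l = 0%N.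
Proof. by rewrite /exponent => ->. Qed.

Lemma val_lab l : (lab l).+1 = (if N %| l then N else l %% N)%N.
Proof.
rewrite /= /dvdn; case: eqP => [l0|/eqP l0].
  by rewrite -modnDml l0 add0n modn_small prednK.
have ->: (l + N.-1 = (l %/ N) * N + (N + (l %% N).-1))%N.
  have := divn_eq l N; lia.
have lt_lN := ltn_pmod l N_gt0.
rewrite modnMDl modnDl modn_small; first by rewrite prednK ?lt0n.
by rewrite (leq_ltn_trans (leq_pred _)).
Qed.

Lemma fwd_a l v : a (lab l :: v) = lab l.+1 :: v.
Proof.
congr (_ :: _); apply: val_inj => /=.
by rewrite -[X in X %% _]addn1 modnDml addn1.
Qed.

Lemma fwd_aX i l v : (a ^+ i) (lab l :: v) = lab (l + i) :: v.
Proof.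
elim: i l => [|i IHi] l; first by rewrite addn0.
by rewrite expgS fwdM fwd_a IHi addSnnS.
Qed.

(** One formula for all labels: [E l] is 0 at the multiples of [N], and the power of [b] is trivial
    at the other labels. *)
Definition b_section (l : nat) : aut := a ^+ E l * b ^+ (N %| l).

Lemma fwd_b l v : b (lab l :: v) = lab l :: b_section l v.
Proof.
rewrite -[LHS]/(lab l :: (if (lab l).+1 == N then b v
                          else (a ^+ entry e (lab l).+1) v)).
rewrite val_lab /b_section /exponent; case: (boolP (N %| l)) => Nl.
  by rewrite eqxx expg0 mul1g expg1.
by rewrite expg0 mulg1 ltn_eqF ?ltn_pmod.
Qed.

Lemma tree_aut_labP (f g : aut) :
  (forall l v, f (lab l :: v) = g (lab l :: v)) -> f = g.
Proof.
move=> fg; apply: tree_aut_ext => -[|x v]; first by rewrite !fwd_root.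
by rewrite (lab_surj x).
Qed.

Lemma a_order : a ^+ N = 1.
Proof.
by apply: tree_aut_labP => l v; rewrite fwd_aX; congr (_ :: _); apply/lab_mod; rewrite modnDr.
Qed.

Lemma aX_mod i j : i = j %[mod N] -> a ^+ i = a ^+ j.
Proof.
suff H m : a ^+ m = a ^+ (m %% N) by move=> ij; rewrite H ij -H.
by rewrite {1}(divn_eq m N) expgnDr mulnC expgnA a_order expg1n mul1g.
Qed.

Lemma fwd_bX i l v : (b ^+ i) (lab l :: v) = lab l :: (b_section l ^+ i) v.
Proof.
elim: i v => [|i IHi] v //.
by rewrite !expgS fwdM fwd_b IHi.
Qed.

(** Induction on the vertex, because the section of [b] at the last letter is [b] itself. *)
Lemma b_expg1 m : (forall l, (N %| E l * m)%N) -> b ^+ m = 1.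
Proof.
move=> NEm; apply: tree_aut_ext; elim=> [|x v IHv]; first by rewrite fwd_root.
rewrite (lab_surj x) fwd_bX; congr (_ :: _).
rewrite /b_section; case: (boolP (N %| _)) => Nl; last first.
  rewrite expg0 mulg1 -expgnA; have /dvdnP[q ->] := NEm x.+1.
  by rewrite mulnC expgnA a_order expg1n.
by rewrite exponent_dvd // expg0 mul1g expg1 IHv.
Qed.

Lemma b_order : b ^+ N = 1.
Proof. by apply: b_expg1 => l; exact: dvdn_mull. Qed.

(* [alpha] and [beta] are the exponent sums of a spelling of [g] as a product of
   powers of [a ^+ r] and of [b]; [g] need not determine them. *)
Inductive word (r : nat) : nat -> nat -> aut -> Prop :=
| word1 : word r 0 0 1
| worda i alpha beta g :
    (r %| i)%N -> word r alpha beta g -> word r (alpha + i) beta (g * a ^+ i)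
| wordb alpha beta g : word r alpha beta g -> word r alpha beta.+1 (g * b).

Lemma wordM r alpha beta g alpha' beta' g' :
  word r alpha beta g -> word r alpha' beta' g' ->
  word r (alpha + alpha') (beta + beta') (g * g').
Proof.
move=> Wg; elim=> [|i {}alpha' {}beta' {}g' ri _ IH|{}alpha' {}beta' {}g' _ IH].
- by rewrite !addn0 mulg1.
- by rewrite mulgA addnA; apply: worda.
- by rewrite mulgA addnS; apply: wordb.
Qed.

Lemma wordX r alpha beta g m :
  word r alpha beta g -> word r (m * alpha) (m * beta) (g ^+ m).
Proof.
move=> Wg; elim: m => [|m IHm]; first exact: word1.
by rewrite !mulSn expgS; apply: wordM.
Qed.

Lemma word_prod r (I : Type) (s : seq I) (A B : I -> nat) (f : I -> aut) :
  (forall i, word r (A i) (B i) (f i)) ->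
  word r (\sum_(i <- s) A i) (\sum_(i <- s) B i) (\prod_(i <- s) f i).
Proof.
move=> Wf; elim: s => [|x s IHs]; first by rewrite !big_nil; apply: word1.
by rewrite !big_cons; apply: wordM.
Qed.

Lemma word_a r i : (r %| i)%N -> word r i 0 (a ^+ i).
Proof.
move=> ri; rewrite -[i in word _ i]add0n -[a ^+ i]mul1g.
by apply: worda => //; apply: word1.
Qed.

Lemma word_bX r m : word r 0 m (b ^+ m).
Proof.
elim: m => [|m IHm]; first exact: word1.
by rewrite expgSr; apply: wordb.
Qed.

Lemma word_dvd r alpha beta g : word r alpha beta g -> (r %| alpha)%N.
Proof. by elim=> // i ? ? ? ri _ IH; apply: dvdn_add. Qed.

Lemma word_b_section r l : (r %| E l)%N -> word r (E l) (N %| l)%N (b_section l).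
Proof.
move=> rE; rewrite -[X in word _ X]addn0 -[X in word _ _ X]add0n.
by apply: wordM; [exact: word_a | exact: word_bX].
Qed.

(** Spellings contain no inverses; these are recovered as powers with exponent [N.-1], since the
    [N]-th powers of [a] and [b] are trivial. *)
Lemma ggs_word g : ggs e g -> exists alpha beta, word 1 alpha beta g.
Proof.
pose H := [set g | (exists alpha beta, word 1 alpha beta g)]%classic.
suff WV x : H x -> H x^-1.
  apply: (_ : ggs e `<=` H)%classic; apply: smallest_sub.
    split=> [|x y /=]; rewrite !inE; first by exists 0%N, 0%N; apply: word1.
    move=> [i [j Wx]] /WV [i' [j' Wy]].
    by exists (i + i')%N, (j + j')%N; apply: wordM.
  move=> x [->|->]; last by exists 0%N, 1%N; exact: (word_bX 1 1).
  by exists 1%N, 0%N; exact: (@word_a 1 1).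
case=> alpha [beta].
elim=> [|i {}alpha {}beta {}g _ _ [i' [j' IH]]|{}alpha {}beta {}g _ [i' [j' IH]]].
- by rewrite invg1; exists 0%N, 0%N; apply: word1.
- exists (i * N.-1 + i')%N, (0 + j')%N; rewrite invgM; apply: wordM => //.
  have <- : a ^+ (i * N.-1) = a ^- i; last exact: word_a.
  apply: (@mulgI _ (a ^+ i)); rewrite mulgV -expgnDr -mulnS prednK // mulnC.
  by rewrite expgnA a_order expg1n.
- exists (0 + i')%N, (N.-1 + j')%N; rewrite invgM; apply: wordM => //.
  have <- : b ^+ N.-1 = b^-1; last exact: word_bX.
  by apply: (@mulgI _ b); rewrite mulgV -expgS prednK // b_order.
Qed.

Lemma word_ggs r alpha beta g : word r alpha beta g -> ggs e g.
Proof.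
have [G1 GB] := generated_group_closed [set a; b]%classic.
have GM := group_closedM (conj G1 GB).
have GA : a \in [pred x | x \in ggs e].
  by rewrite !inE => H [_]; apply; left.
have Gb : b \in [pred x | x \in ggs e].
  by rewrite !inE => H [_]; apply; right.
move=> Wg; apply/set_mem; elim: Wg => [//|i _ _ {}g _ _ IH|_ _ {}g _ IH]; apply: (GM) => //.
by elim: i => // i IHi; rewrite expgS; apply: (GM).
Qed.

Lemma fwd_word_lab r alpha beta g : word r alpha beta g ->
  forall l v, exists w, g (lab l :: v) = lab (l + alpha) :: w.
Proof.
elim=> [|i {}alpha {}beta {}g _ _ IH|{}alpha {}beta {}g _ IH] l v.
- by exists v; rewrite addn0.
- by have [w gw] := IH l v; exists w; rewrite fwdM gw fwd_aX addnA.
- by have [w gw] := IH l v; eexists; rewrite fwdM gw fwd_b.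
Qed.

(* The shifts [L] record the exponents of [a] preceding each [b] of the word. *)
Lemma word_sections r r' alpha beta g :
  (r %| N)%N -> (forall l, (r %| l)%N -> (r' %| E l)%N) -> word r alpha beta g ->
  exists (L : seq nat) (s : nat -> aut),
    [/\ size L = beta, all (dvdn r) L,
        forall l v, g (lab l :: v) = lab (l + alpha) :: s l v &
        forall l, let A := (\sum_(i <- L) E (l + i))%N in
          if (r %| l)%N then word r' A (\sum_(i <- L) (N %| l + i)%N) (s l)
          else s l = a ^+ A].
Proof.
move=> rN r'E.
elim=> [|i {}alpha {}beta {}g ri _ [L [s [sL rL gs Ws]]]
  |{}alpha {}beta {}g Wg [L [s [sL rL gs Ws]]]].
- exists [::], (fun=> 1); split=> // l /=; first by rewrite addn0.
  by rewrite !big_nil; case: ifP => // _; apply: word1.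
- by exists L, s; split=> // l v; rewrite fwdM gs fwd_aX addnA.
- exists (rcons L alpha), (fun l => s l * b_section (l + alpha)); split.
  + by rewrite size_rcons sL.
  + by rewrite all_rcons rL (word_dvd Wg).
  + by move=> l v; rewrite fwdM gs fwd_b.
  move=> l; rewrite -cats1 !big_cat !big_seq1 /=.
  have := Ws l; case: ifP => rl Wl.
    apply: wordM => //; apply/word_b_section/r'E.
    by rewrite dvdn_add ?(word_dvd Wg).
  rewrite Wl expgnDr /b_section; case: (boolP (N %| _)) => [Nl|_]; last by rewrite expg0 mulg1.
  by move: (dvdn_trans rN Nl); rewrite dvdn_addl ?(word_dvd Wg) ?rl.
Qed.

Lemma fwd_expg_sections (g : aut) alpha (s : nat -> aut) :
  (forall l v, g (lab l :: v) = lab (l + alpha) :: s l v) ->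
  forall m l v, (g ^+ m) (lab l :: v)
    = lab (l + m * alpha) :: (\prod_(j <- iota 0 m) s (l + j * alpha)) v.
Proof.
move=> gs m l v; elim: m => [|m IHm]; first by rewrite big_nil addn0.
rewrite expgSr fwdM IHm gs -[in RHS]addn1 iotaD.
by rewrite big_cat big_seq1 add0n mulnDl mul1n addnA.
Qed.

End Words.

(** * Powers stabilising the first level *)

Section Powers.
Variables p n : nat.
Hypothesis N_gt1 : (1 < p ^ n)%N.
Variable e : defining_vector p n.

Local Notation N := (p ^ n)%N.
Local Notation a := (ggs_a p n).
Local Notation b := (ggs_b e).
Local Notation E := (exponent e).
Local Notation lab := (lab N_gt1).

Let N_gt0 : (0 < N)%N. Proof. exact: ltnW. Qed.

(** For [r = p ^ c] with [c <= n] and [l = 0] this is S[c] modulo [p ^ n]; other values of [l] give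
    the sums over the remaining residue classes modulo [r]. *)
Definition class_sum (r l : nat) : nat := (\sum_(j < N %/ r) E (l + r * j))%N.

(** Repeated addition of [alpha] runs through one residue class modulo [r], because [alpha %/ r] is
    a unit modulo [N %/ r]; the shift [i] only moves the starting point. *)
Lemma orbit_sum (F : nat -> nat) r alpha i l :
  (forall x, F (x + N)%N = F x) ->
  (r %| N)%N -> gcdn alpha N = r -> (r %| i)%N ->
  (\sum_(j <- iota 0 (N %/ r)) F (l + j * alpha + i) =
   \sum_(j < N %/ r) F (l + r * j))%N.
Proof.
move=> FN rN gr /dvdnP[i' ->].
have r_gt0 : (0 < r)%N by apply: dvdn_gt0 rN.
have NE : N = (N %/ r * r)%N by rewrite divnK.
have aE : alpha = (alpha %/ r * r)%N by rewrite divnK // -gr dvdn_gcdl.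
have cu : coprime (alpha %/ r) (N %/ r).
  by rewrite /coprime -(eqn_pmul2r r_gt0) muln_gcdl -NE -aE gr mul1n.
pose H x := F (l + r * (x + i'))%N.
have HM x : H (x + N %/ r)%N = H x.
  by rewrite /H -[in RHS]FN; congr F; rewrite [X in (_ = _ + X)%N]NE; lia.
transitivity (\sum_(j < N %/ r) H (j * (alpha %/ r)))%N.
  rewrite -{1}(subn0 (N %/ r)) big_mkord; apply: eq_bigr => j _.
  by rewrite /H {1}aE; congr F; move: (alpha %/ r)%N => q; nia.
rewrite (sum_periodic_mul cu HM).
apply: (sum_periodic i' (F := fun x => F (l + r * x)%N)) => x.
by rewrite -[in RHS]FN; congr F; rewrite [X in (_ = _ + X)%N]NE; lia.
Qed.

Lemma class_sum_dvd r l : (r %| N)%N -> (r %| l)%N -> class_sum r l = class_sum r 0.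
Proof.
move=> rN /dvdnP[l' ->].
have NE : N = (N %/ r * r)%N by rewrite divnK.
rewrite /class_sum -(sum_periodic l' (F := fun x => E (0 + r * x)%N)) => [|x].
  by apply: eq_bigr => j _; congr E; lia.
by rewrite -[in RHS](exponentD e); congr E; rewrite [X in (_ = _ + X)%N]NE; lia.
Qed.

(** The label [N] occurs once in the class, so each [b] of a spelling contributes exactly one [b] to
    the product of the sections along this orbit. *)
Lemma class_count r l :
  (r %| N)%N -> (r %| l)%N -> (\sum_(j < N %/ r) (N %| l + r * j) = 1)%N.
Proof.
move=> rN /dvdnP[l' ->].
have r_gt0 : (0 < r)%N by apply: dvdn_gt0 rN.
have M_gt0 : (0 < N %/ r)%N by rewrite divn_gt0 // dvdn_leq.
have NE : N = (N %/ r * r)%N by rewrite divnK.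
transitivity (\sum_(j < N %/ r) (N %/ r %| j + l'))%N.
  apply: eq_bigr => j _; congr nat_of_bool.
  by rewrite -[in RHS](dvdn_pmul2r r_gt0) -NE; congr (_ %| _); lia.
rewrite (@sum_periodic _ (fun x => N %/ r %| x : nat)%N) => [|x]; last first.
  by rewrite dvdn_addl.
rewrite (bigD1 (Ordinal M_gt0)) //= dvdn0 big1 // => j j0.
by rewrite gtnNdvd // lt0n.
Qed.

(** The section of the power at [l] is the product of the sections of [g] along the orbit of [l].
    Each of the [beta] shifts contributes a full class sum and, on the multiples of [r], exactly one
    [b]; hence the exponent sum of [b] is preserved. *)
Lemma power_sections r r' alpha beta g :
  (r %| N)%N -> (forall l, (r %| l)%N -> (r' %| E l)%N) ->
  word e r alpha beta g -> gcdn alpha N = r ->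
  exists s : nat -> tree_aut 'I_N,
    (forall l v, (g ^+ (N %/ r)) (lab l :: v) = lab l :: s l v) /\
    (forall l, if (r %| l)%N then word e r' (beta * class_sum r 0) beta (s l)
               else s l = a ^+ (beta * class_sum r l)).
Proof.
move=> rN r'E Wg gr.
have [L [s [sL rL gs Ws]]] := word_sections N_gt1 rN r'E Wg.
have ra : (r %| alpha)%N by exact: word_dvd Wg.
have sumA l : (\sum_(j <- iota 0 (N %/ r)) \sum_(i <- L) E (l + j * alpha + i) =
               beta * class_sum r l)%N.
  rewrite exchange_big /= -sL -sum1_size big_distrl /=.
  rewrite !big_seq; apply: eq_bigr => i /(allP rL) ri; rewrite mul1n.
  by rewrite (@orbit_sum _ r) //; exact: exponentD.
exists (fun l => \prod_(j <- iota 0 (N %/ r)) s (l + j * alpha)%N); split=> l.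
  move=> v; rewrite (fwd_expg_sections gs); congr (_ :: _); apply: lab_mod.
  have [u ->] := dvdnP ra; have NE := divnK rN.
  by rewrite mulnCA NE addnC modnMDl.
case: ifP => rl; last first.
  rewrite -sumA.
  elim: (iota _ _) => [|j t IHt]; first by rewrite !big_nil.
  rewrite !big_cons expgnDr IHt; congr (_ * _).
  by have := Ws (l + j * alpha)%N; rewrite dvdn_addl ?dvdn_mull // rl.
rewrite -(class_sum_dvd rN rl) -sumA {sumA}.
have -> : beta = (\sum_(j <- iota 0 (N %/ r)) \sum_(i <- L) (N %| l + j * alpha + i))%N.
  rewrite exchange_big /= -sL -sum1_size.
  rewrite !big_seq; apply: eq_bigr => i /(allP rL) ri.
  rewrite (@orbit_sum (fun x => N %| x : nat)%N r) // => [|x].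
    by rewrite class_count.
  by rewrite dvdn_addl.
apply: word_prod => j.
by have := Ws (l + j * alpha)%N; rewrite dvdn_addl ?dvdn_mull // rl.
Qed.

End Powers.

(** * Descent along the chain of case (i) *)

Section Levels.
Variables p n : nat.
Hypothesis N_gt1 : (1 < p ^ n)%N.
Variable e : defining_vector p n.

Local Notation N := (p ^ n)%N.
Local Notation a := (ggs_a p n).
Local Notation b := (ggs_b e).
Local Notation E := (exponent e).
Local Notation lab := (lab N_gt1).
Local Notation aut := (tree_aut 'I_N).

Let N_gt0 : (0 < N)%N. Proof. exact: ltnW. Qed.

Lemma eq_level_lab k (f g : aut) :
  eq_level k.+1 f g <-> forall l v, size v = k -> f (lab l :: v) = g (lab l :: v).
Proof.
split=> [fg l v vk|fg [//|x v] [vk]]; first by apply: fg; rewrite /= vk.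
by rewrite (lab_surj N_gt1 x) fg.
Qed.

Lemma eq_level_aX k i j : (0 < k)%N -> eq_level k (a ^+ i) (a ^+ j) -> i = j %[mod N].
Proof.
move=> k_gt0 /(eq_level_le (lab 0) k_gt0) /eq_level_lab/(_ 0 [::] erefl).
by rewrite !fwd_aX !add0n => -[] /eqP; rewrite eqn_modDr => /eqP.
Qed.

Lemma eq_level_aX1 k i : (0 < k)%N -> eq_level k (a ^+ i) 1 -> N %| i.
Proof. by move=> k_gt0 /(@eq_level_aX _ _ 0 k_gt0); rewrite mod0n => /eqP. Qed.

Lemma word_level1 r alpha beta g : word e r alpha beta g -> eq_level 1 g (a ^+ alpha).
Proof.
move=> Wg; apply/eq_level_lab => l [] // _.
have [w /[dup] gl ->] := fwd_word_lab N_gt1 Wg l [::].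
rewrite fwd_aX; congr (_ :: _).
by apply/size0nil; move/(congr1 size): gl; rewrite size_fwd => -[].
Qed.

Lemma bX_level2 beta l : eq_level 2 (b ^+ beta) 1 -> N %| (beta * E l)%N.
Proof.
move=> /eq_level_lab b1; apply: (@eq_level_aX1 1) => // v v1.
have := b1 l v v1; rewrite fwd_bX => -[].
rewrite /b_section; case: (boolP (N %| l)) => Nl.
  by rewrite (exponent_dvd e Nl) muln0 expg0.
by rewrite expg0 mulg1 -expgnA mulnC.
Qed.

Lemma word_full alpha beta g : word e N alpha beta g -> g = b ^+ beta.
Proof.
elim=> // [i {}alpha {}beta {}g Ni _ ->|{}alpha {}beta {}g _ ->]; last by rewrite expgSr.
by have [q ->] := dvdnP Ni; rewrite mulnC expgnA a_order // expg1n mulg1.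
Qed.

Lemma fwd_stabX (g : aut) (s : nat -> aut) :
  (forall l v, g (lab l :: v) = lab l :: s l v) ->
  forall m l v, (g ^+ m) (lab l :: v) = lab l :: (s l ^+ m) v.
Proof.
move=> gs; elim=> // m IHm l v.
by rewrite !expgS fwdM gs IHm.
Qed.

(* In case (i), [r] runs through 1, p^{R_0}, p^{R_1}, ..., p^n. *)
Inductive chain : nat -> Prop :=
| chain_last : chain N
| chain_step r :
    (r < N)%N -> (r %| N)%N -> (exists l, ~~ (N %| class_sum e r l)) ->
    (forall l, (r %| l)%N -> (gcdn (class_sum e r 0) N %| E l)%N) ->
    chain (gcdn (class_sum e r 0) N) -> chain r.

(* The power [N %/ r] of [g] fixes the first level; its sections are words for the
   next term [r'] of the chain at the labels divisible by [r], and powers of [a]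
   determined by [beta] elsewhere. *)
Lemma chain_power r : (exists l, ~~ (N %| E l)) -> chain r -> forall k,
  (0 < k)%N -> (r < N)%N || (1 < k)%N ->
  exists M, forall g g' alpha alpha' beta,
    word e r alpha beta g -> word e r alpha' beta g' ->
    gcdn alpha N = r -> gcdn alpha' N = r -> coprime beta N ->
    (k = 1%N -> alpha = alpha') ->
    eq_level k (g ^+ M) (g' ^+ M) /\ ~ eq_level k (g ^+ M) 1.
Proof.
move=> [l0 El0]; elim=> [|{}r rltN rN [l1 Tl1] r'E _ IH] [//|k] _.
  rewrite ltnn ltnS /= => k_gt0; exists 1%N => g g' alpha alpha' beta.
  move=> /word_full-> /word_full-> _ _ cb _; split=> //; rewrite expg1.
  move/(@eq_level_le _ (lab 0) 2 k.+1 _ _ k_gt0)/(@bX_level2 _ l0).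
  by rewrite Gauss_dvdr 1?coprime_sym // (negPf El0).
move=> _; set r' := gcdn (class_sum e r 0) N in r'E IH.
have r_gt0 : (0 < r)%N by apply: dvdn_gt0 rN.
have gcd_r' beta : coprime beta N -> gcdn (beta * class_sum e r 0) N = r'.
  by move=> cb; rewrite /r' gcdnC Gauss_gcdr 1?coprime_sym // gcdnC.
have [k0|k_gt0] := posnP k.
  exists 1%N => g g' alpha alpha' beta Wg Wg' ga _ _ aa; rewrite !expg1 k0.
  have {}aa : alpha = alpha' by apply: aa; rewrite k0.
  subst alpha'.
  split.
    by apply: eq_level_trans (word_level1 Wg) (eq_level_sym (word_level1 Wg')).
  move/(eq_level_trans (eq_level_sym (word_level1 Wg)))/eq_level_aX1 => /(_ isT).
  by move/gcdn_idPr; rewrite ga => rE; move: rltN; rewrite rE ltnn.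
(* Corresponding sections at multiples of [r] have the same exponent sum [beta * class_sum e r 0],
   which meets the level-one condition of the induction hypothesis. Label 0 witnesses
   nontriviality. *)
have [r'k|] := boolP ((r' < N)%N || (1 < k)%N).
  have [M' HM'] := IH k k_gt0 r'k.
  exists (N %/ r * M')%N => g g' alpha alpha' beta Wg Wg' ga ga' cb _.
  have [s [gs Ws]] := power_sections N_gt1 rN r'E Wg ga.
  have [s' [gs' Ws']] := power_sections N_gt1 rN r'E Wg' ga'.
  rewrite !expgnA; split.
    apply/eq_level_lab => l v vk; rewrite (fwd_stabX gs) (fwd_stabX gs').
    congr (_ :: _); have := Ws l; have := Ws' l; case: ifP => _ Wl' Wl.
      by have [-> //] := HM' _ _ _ _ _ Wl Wl' (gcd_r' _ cb) (gcd_r' _ cb) cb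
        (fun=> erefl).
    by rewrite Wl Wl'.
  move/eq_level_lab => g1; have := Ws 0; rewrite dvdn0 => W0.
  have [_] := HM' _ _ _ _ _ W0 W0 (gcd_r' _ cb) (gcd_r' _ cb) cb (fun=> erefl).
  by apply=> v vk; have := g1 0 v vk; rewrite (fwd_stabX gs) => -[].
rewrite negb_or -!leqNgt => /andP[Nr' k_le1].
have r'N : r' = N by apply/eqP; rewrite eqn_leq Nr' dvdn_leq ?dvdn_gcdr.
(* Now the sections at multiples of [r] are powers of [b], invisible on level one, so nontriviality
   is read off at [l1], which lies outside this class. *)
have {k k_gt0 k_le1}-> : k = 1%N by lia.
exists (N %/ r)%N => g g' alpha alpha' beta Wg Wg' ga ga' cb _.
have [s [gs Ws]] := power_sections N_gt1 rN r'E Wg ga.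
have [s' [gs' Ws']] := power_sections N_gt1 rN r'E Wg' ga'.
split.
  apply/eq_level_lab => l v vk; rewrite gs gs'.
  congr (_ :: _); have := Ws l; have := Ws' l; case: ifP => _; last by move=> -> ->.
  by rewrite r'N => /word_full-> /word_full->.
move/eq_level_lab => g1; have := Ws l1; case: ifP => rl1.
  by move: Tl1; rewrite class_sum_dvd // -r'N dvdn_gcdl.
move=> sl1; have : eq_level 1 (a ^+ (beta * class_sum e r l1)) 1.
  by rewrite -sl1 => v vk; have := g1 l1 v vk; rewrite gs => -[].
by move/eq_level_aX1 => /(_ isT); rewrite Gauss_dvdr 1?coprime_sym // (negPf Tl1).
Qed.

End Levels.

Lemma sum_blocks (G : nat -> nat) q M :
  (\sum_(x < q * M) G x = \sum_(i < q) \sum_(j < M) G (i + q * j))%N.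
Proof.
elim: M => [|M IHM].
  rewrite muln0 big_ord0; symmetry; apply: big1 => i _; exact: big_ord0.
rewrite mulnSr big_split_ord /= IHM -big_split /=; apply: eq_bigr => i _.
by rewrite big_ord_recr /= [(_ * _ + _)%N]addnC.
Qed.

(** * Case (i): the chain given by the numbers R_j *)

Section ClassEi.
Variables p n : nat.
Hypothesis p_prime : prime p.
Hypothesis N_gt1 : (1 < p ^ n)%N.
Variable e : defining_vector p n.

Local Notation N := (p ^ n)%N.
Local Notation E := (exponent e).

Let N_gt0 : (0 < N)%N. Proof. exact: ltnW. Qed.

(** As [p ^ r] divides the modulus, divisibility by it survives reduction modulo [N]. *)
Lemma pdvdP r (x : 'Z_N) : (r <= n)%N -> pdvd r x = (p ^ r %| x)%N.
Proof.
move=> rn; have rN : (p ^ r %| N)%N by rewrite dvdn_exp2l.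
apply/existsP/idP => [[c /eqP ->]|/dvdnP[q xq]].
  rewrite -[c]natr_Zp -GRing.natrM val_Zp_nat // /dvdn modn_dvdm // modnMr //.
by exists q%:R%R; rewrite -GRing.natrM mulnC -xq natr_Zp.
Qed.

Lemma pdvd_ge r (x : 'Z_N) : (n <= r)%N -> pdvd r x -> x = 0%R.
Proof.
move=> nr /existsP[c /eqP ->].
have -> : ((p ^ r)%:R = 0 :> 'Z_N)%R; last exact: GRing.mul0r.
by apply: val_inj; rewrite /= val_Zp_nat //; apply/eqP; rewrite -/(dvdn _ _) dvdn_exp2l.
Qed.

Lemma natr_exponent l : ((E l)%:R = if (N %| l)%N then 0 else entry e (l %% N)%N :> 'Z_N)%R.
Proof. by rewrite /exponent; case: ifP => // _; rewrite natr_Zp. Qed.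

(** The additional term at label 0 vanishes. After sorting the labels by residue modulo [p ^ c],
    only residue 0 contributes. *)
Lemma Ssum_class_sum c : (c <= n)%N -> Ssum e c = ((class_sum e (p ^ c) 0)%:R)%R.
Proof.
move=> cn; have p_gt0 := prime_gt0 p_prime.
have rN : (p ^ c * (N %/ p ^ c) = N)%N by rewrite mulnC divnK ?dvdn_exp2l.
pose G l := if (p ^ c %| l)%N then E l else 0%N.
transitivity ((\sum_(l < N) G l)%:R : 'Z_N)%R.
  rewrite GRing.natr_sum /Ssum -(big_mkord xpredT (fun l => ((G l)%:R : 'Z_N)%R)).
  rewrite [RHS]big_ltn // {1}/G (exponent_dvd e (dvdn0 _)) if_same GRing.add0r.
  rewrite big_mkcond /=; rewrite !big_nat; apply: eq_bigr => l /andP[l_gt0 lN].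
  rewrite /G; case: ifP => // _; rewrite natr_exponent gtnNdvd // modn_small //.
congr (_%:R)%R; rewrite /class_sum.
transitivity (\sum_(l < p ^ c * (N %/ p ^ c)) G l)%N; first by rewrite rN.
rewrite sum_blocks.
have r_gt0 : (0 < p ^ c)%N by rewrite expn_gt0 p_gt0.
rewrite (bigD1 (Ordinal r_gt0)) //= [X in (_ + X)%N]big1 ?addn0 => [|i i0].
  by apply: eq_bigr => j _; rewrite /G add0n dvdn_mulr.
apply: big1 => j _; rewrite /G dvdn_addl ?dvdn_mulr // gtnNdvd // lt0n.
exact: i0.
Qed.

Lemma dvd_class_sum c r : (c <= n)%N -> (r <= n)%N ->
  pdvd r (Ssum e c) = (p ^ r %| class_sum e (p ^ c) 0)%N.
Proof.
move=> cn rn; rewrite pdvdP // Ssum_class_sum // val_Zp_nat //.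
by rewrite /dvdn modn_dvdm // dvdn_exp2l.
Qed.

Lemma common_val_le c : (common_val e c <= n)%N.
Proof. by apply/bigmax_leqP => r _; rewrite -ltnS. Qed.

Lemma common_val_dvd c l : (p ^ c %| l)%N -> (p ^ common_val e c %| E l)%N.
Proof.
move=> cl; rewrite /exponent; case: ifP => // Nl.
pose P (r : 'I_n.+1) := [forall l : 'I_N, (0 < l)%N && (p ^ c %| l)%N ==> pdvd r (entry e l)].
have P0 : P ord0.
  by apply/forallP => x; apply/implyP => _; rewrite pdvdP // expn0 dvd1n.
have [|r Pr Er] := eq_bigmax_cond (fun r : 'I_n.+1 => r : nat) (A := P).
  by apply/card_gt0P; exists ord0.
have -> : common_val e c = r by [].
move/forallP/(_ (Ordinal (ltn_pmod l N_gt0))): Pr => /=.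
rewrite lt0n -/(dvdn _ _) Nl pdvdP // -1?ltnS //=.
have [cn|nc] := leqP c n.
  by rewrite {1}/dvdn modn_dvdm ?dvdn_exp2l // -/(dvdn _ _) cl.
by move: Nl; rewrite (dvdn_trans _ cl) // dvdn_exp2l // ltnW.
Qed.

Lemma common_val_mono c d : (c <= d)%N -> (common_val e c <= common_val e d)%N.
Proof.
move=> cd; apply/bigmax_leqP => r /forallP Pr; apply: (bigmax_sup r) => //.
apply/forallP => l; apply/implyP => /andP[l0 dl].
by move/implyP: (Pr l); rewrite l0 (dvdn_trans _ dl) ?dvdn_exp2l //; apply.
Qed.

Lemma gcd_pexp x t : (t < n)%N -> (p ^ t %| x)%N -> ~~ (p ^ t.+1 %| x)%N ->
  gcdn x N = (p ^ t)%N.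
Proof.
move=> tn tx t1x; have /(dvdn_pfactor _ _ p_prime)[s _ Es] := dvdn_gcdr x N.
have ts : (t <= s)%N.
  by rewrite -(dvdn_Pexp2l _ _ (prime_gt1 p_prime)) -Es dvdn_gcd tx dvdn_exp2l // ltnW.
suff st : (s <= t)%N by rewrite Es; congr (_ ^ _)%N; apply/eqP; rewrite eqn_leq st.
rewrite leqNgt; apply/negP => lt_ts; case/negP: t1x.
by apply: dvdn_trans (dvdn_gcdl x N); rewrite Es dvdn_exp2l.
Qed.

Lemma class_sum_split r r' : (0 < r)%N -> (r %| r')%N -> (r' %| N)%N ->
  class_sum e r 0 = (\sum_(i < r' %/ r) class_sum e r' (r * i))%N.
Proof.
move=> r_gt0 /dvdnP[q ->] qrN; rewrite mulnK //.
have [M NE] := dvdnP qrN; have qr_gt0 : (0 < q * r)%N by apply: dvdn_gt0 qrN.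
rewrite /class_sum.
have -> : (N %/ r = q * M)%N by rewrite NE mulnA mulnK // mulnC.
have -> : (N %/ (q * r) = M)%N by rewrite NE mulnK.
rewrite (sum_blocks (fun x => E (0 + r * x)%N)); apply: eq_bigr => i _; apply: eq_bigr => j _.
by congr E; lia.
Qed.

(** The equalities between t_j and R_j say that the gcd attached to one term of the chain is the
    next term. *)
Lemma class_E_i_chain : (exists l, ~~ (N %| E l)) -> class_E_i e ->
  chain e 1 /\ ~~ (N %| class_sum e 1 0).
Proof.
have p_gt1 := prime_gt1 p_prime.
case=> l0 El0 [m [t [mt tR Rm]]].
(* The exponents 0, R_0, R_1, ... of the chain, shifted by one from the indexing of R. *)
pose c j := if j is j'.+1 then Rseq e j' else 0%N.
have RE j : Rseq e j = common_val e (c j) by case: j.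
have cn j : (c j <= n)%N by case: j => [|j] //=; rewrite RE common_val_le.
have c_mono j : (c j <= c j.+1)%N.
  by elim: j => // j /common_val_mono; rewrite -!RE.
have m_gt0 : (0 < m)%N.
  rewrite lt0n; apply/eqP => m0; rewrite m0 /= in Rm.
  by have := @common_val_dvd 0 l0; rewrite Rm expn0 dvd1n (negPf El0) => /(_ isT).
move: mt; rewrite /mt_spec; case: ifP => [_ [m0]|NS0]; first by rewrite m0 in m_gt0.
move=> [_ [t_lt tm_ge] S0 Sk Sm].
have gcd_lt j : (j < m)%N -> gcdn (class_sum e (p ^ c j) 0) N = (p ^ c j.+1)%N.
  move=> jm; have tjn := t_lt _ jm; rewrite /= -tR //.
  have : pdvd (t j) (Ssum e (c j)) && ~~ pdvd (t j).+1 (Ssum e (c j)).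
    case: j jm {tjn} => [|j] jm //=; rewrite -tR 1?ltnW //.
    by apply: (Sk j.+1); rewrite jm.
  rewrite !dvd_class_sum // 1?ltnW // => /andP[]; exact: gcd_pexp.
(* At the last step only divisibility is prescribed, but [n <= t m] makes the sum vanish modulo
   [N]. *)
have gcd_m : gcdn (class_sum e (p ^ c m) 0) N = (p ^ c m.+1)%N.
  rewrite /= Rm; apply/gcdn_idPr.
  rewrite -dvd_class_sum //.
  case: m m_gt0 Sm tm_ge tR {Rm t_lt Sk gcd_lt} => // m _ Sm tm_ge tR.
  have -> : Ssum e (c m.+1) = 0%R by apply: pdvd_ge tm_ge _; rewrite /= -tR.
  by rewrite pdvdP.
have NS1 : ~~ (N %| class_sum e 1 0).
  by rewrite -(expn0 p) -dvd_class_sum // NS0.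
split=> //.
(* The sum at the preceding term is a total of class sums at this one; if all of these vanished
   modulo [N], so would it, against [t j < n]. *)
have nonvanishing j : (j <= m)%N -> exists l, ~~ (N %| class_sum e (p ^ c j) l).
  case: j => [_|j jm]; first by exists 0%N.
  apply: contrapT => all0.
  have /gcdn_idPr : (N %| class_sum e (p ^ c j) 0)%N.
    rewrite (@class_sum_split _ (p ^ c j.+1)) ?expn_gt0 ?prime_gt0 ?dvdn_exp2l //.
    apply: dvdn_sum => i _; apply: contrapT => /negP Ni; apply: all0.
    by eexists; exact: Ni.
  rewrite gcd_lt // /= -tR // => /eqP; rewrite eqn_exp2l // => /eqP tn.
  by move: (t_lt _ jm); rewrite tn ltnn.
(* The chain is built from its end: [i] counts the terms left before R_m = n. *)
suff H i j : (i + j = m.+1)%N -> chain e (p ^ c j) by apply: (H m.+1 0%N); rewrite addn0.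
elim: i j => [|i IHi] j; first by rewrite add0n => ->; rewrite /= Rm; exact: chain_last.
rewrite addSn => -[ij]; have jm : (j <= m)%N by rewrite -ij leq_addl.
have gcd_j : gcdn (class_sum e (p ^ c j) 0) N = (p ^ c j.+1)%N.
  by move: jm; rewrite leq_eqVlt => /predU1P[->|/gcd_lt].
apply: chain_step.
- case: j {ij gcd_j} jm => [|j] jm /=; first by rewrite expn0.
  by rewrite -tR // ltn_exp2l // t_lt.
- by rewrite dvdn_exp2l.
- exact: nonvanishing.
- by move=> l cl; rewrite gcd_j /= RE common_val_dvd.
- by rewrite gcd_j; apply: IHi; rewrite addnS ij.
Qed.

End ClassEi.

(* While [f] has period [2 ^ n.+1], either [f (+) f (_ + 2 ^ n)] is nonzero with
   period [2 ^ n], or [f] itself has period [2 ^ n]. *)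
Lemma shift_space_true (V : (nat -> bool) -> Prop) :
  (forall C C', V C -> V C' -> V (fun l => C l (+) C' l)) ->
  (forall C, V C -> V (fun l => C l.+1)) ->
  forall n f, V f -> (forall l, f (l + 2 ^ n)%N = f l) -> (exists l, f l) ->
  V (fun=> true).
Proof.
move=> VD VS; elim=> [|n IHn] f Vf fn [l0 fl0].
  suff -> : (fun=> true) = f by [].
  have f0 l : f l = f 0%N by elim: l => // l <-; rewrite -[in LHS]addn1 fn.
  by apply/funext => l; rewrite f0 -(f0 l0).
have Vshift i : V (fun l => f (l + i)%N).
  elim: i => [|i /VS]; first by under eq_fun do rewrite addn0.
  by under eq_fun do rewrite addSnnS.
have [[l gl]|g0] := EM (exists l, f l (+) f (l + 2 ^ n)%N).
  apply: (IHn _ (VD _ _ Vf (Vshift (2 ^ n)%N))); last by exists l.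
  by move=> l1; rewrite -addnA addnn -mul2n -expnS fn addbC.
apply: (IHn f Vf); last by exists l0.
move=> l; apply: contrapT => ne; apply: g0; exists l.
by case: (f l) (f _) ne => [] [] // [].
Qed.

(** * Case (ii): dihedral sections and conjugate powers *)

Section ClassEii.
Variables n : nat.
Hypothesis N_gt1 : (1 < 2 ^ n)%N.
Variable e : defining_vector 2 n.

Local Notation N := (2 ^ n)%N.
Local Notation h := (2 ^ n.-1)%N.
Local Notation a := (ggs_a 2 n).
Local Notation b := (ggs_b e).
Local Notation E := (exponent e).
Local Notation lab := (lab N_gt1).
Local Notation aut := (tree_aut 'I_N).

Hypothesis hE : forall l, (h %| E l)%N.
Hypothesis Eh : E h = 0%N.
Hypothesis NT : (N %| class_sum e 1 0)%N.
Hypothesis E_neq0 : exists l, ~~ (N %| E l).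

Let N_gt0 : (0 < N)%N. Proof. exact: ltnW. Qed.
Let h_gt0 : (0 < h)%N. Proof. by rewrite expn_gt0. Qed.
Let NE : N = (2 * h)%N.
Proof. by rewrite -expnS prednK //; case: (n) N_gt1. Qed.

(** For [x] divisible by [h], this bit determines [a ^+ x], since [N = 2 * h]. *)
Definition parity (x : nat) : bool := odd (x %/ h).

Lemma parityD x y : (h %| x)%N -> (h %| y)%N -> parity (x + y) = parity x (+) parity y.
Proof. by move=> hx hy; rewrite /parity divnDl // oddD. Qed.

Lemma parity_dvd x : (h %| x)%N -> parity x = ~~ (N %| x)%N.
Proof. by move=> /dvdnP[q ->]; rewrite /parity mulnK // NE dvdn_pmul2r // dvdn2 negbK. Qed.

Lemma aX_parity x y :
  (h %| x)%N -> (h %| y)%N -> parity x = parity y -> a ^+ x = a ^+ y.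
Proof.
move=> /dvdnP[q ->] /dvdnP[q' ->]; rewrite /parity !mulnK // => qq.
apply: aX_mod => //; rewrite NE -!muln_modl.
by congr (_ * h)%N; rewrite !modn2 qq.
Qed.

Lemma b_square : b * b = 1.
Proof.
rewrite -expg2; apply: b_expg1 => // l.
by have [q ->] := dvdnP (hE l); rewrite NE -mulnA [(h * 2)%N]mulnC dvdn_mull.
Qed.

(* When [2 * h = N], the group generated by [a ^+ h] and [b] is dihedral of order 8,
   and [b] has exactly the two conjugates [b_conj d]. *)
Definition b_conj (d : bool) : aut := b ^ (a ^+ (h * d)).

Lemma b_conjF : b_conj false = b.
Proof. by rewrite /b_conj muln0 expg0 conjg1. Qed.

Lemma fwd_b_conjT l v :
  b_conj true (lab l :: v) = lab l :: b_section e (l + h) v.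
Proof.
have aV : (a ^+ h)^-1 = a ^+ h.
  by apply: (@mulgI _ (a ^+ h)); rewrite mulgV -expgnDr addnn -mul2n -NE a_order.
rewrite /b_conj muln1 conjgE aV !fwdM fwd_aX fwd_b fwd_aX; congr (_ :: _).
by apply: lab_mod; rewrite -addnA addnn -mul2n -NE modnDr.
Qed.

(** At every label the two sections are either both powers of [a], or [b] and [a ^+ E h], which is
    trivial by [Eh]. *)
Lemma b_conjC : commute (b_conj false) (b_conj true).
Proof.
apply: (tree_aut_labP (N_gt1 := N_gt1)) => l v.
rewrite b_conjF [LHS]fwdM [RHS]fwdM fwd_b !fwd_b_conjT fwd_b; congr (_ :: _).
suff : b_section e l * b_section e (l + h) = b_section e (l + h) * b_section e l.
  by move/(congr1 (fun f : aut => f v)).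
rewrite /b_section; have [Nl|Nl] := boolP (N %| l)%N.
  rewrite (exponent_mod e (l := l + h) (m := h)) ?Eh; last first.
    by case/dvdnP: Nl => q ->; rewrite modnMDl.
  rewrite exponent_dvd // dvdn_addr // gtnNdvd ?expg0 ?mulg1 ?mul1g //.
  by rewrite NE mul2n -addnn -[X in (X < _)%N]addn0 ltn_add2l.
have [Nlh|Nlh] := boolP (N %| l + h)%N; last by rewrite !expg0 !mulg1 -!expgnDr addnC.
rewrite (exponent_mod e (l := l) (m := h)) ?Eh ?expg0 ?mul1g ?mulg1 //.
apply/eqP; rewrite -(eqn_modDr h) addnn -mul2n -NE modnn.
exact: Nlh.
Qed.

Lemma b_conj_word alpha beta g d :
  word e h alpha beta g -> b_conj d ^ g = b_conj (d (+) parity alpha).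
Proof.
elim=> [|i {}alpha {}beta {}g hi Wg IH|{}alpha {}beta {}g Wg IH].
- by rewrite conjg1 /parity div0n addbF.
- rewrite conjgM IH parityD ?(word_dvd Wg) // addbA; move: (_ (+) _) => {IH}d.
  rewrite /b_conj -conjgM -expgnDr; congr (_ ^ _).
  apply: aX_parity; rewrite ?dvdn_add ?dvdn_mulr //.
  rewrite parityD ?dvdn_mulr // /parity !mulKn //.
  by case: (odd _) d => [] [].
- rewrite conjgM IH; apply/conjg_fixP/commgP.
  case: (_ (+) _); rewrite -b_conjF; last exact: commute_refl.
  by apply: commute_sym; exact: b_conjC.
Qed.

(** Powers of [a ^+ h] move to the left past the commuting involutions [b_conj false] and
    [b_conj true]; the parity of [beta] tells how many of these remain modulo 2. *)
Lemma word_normal alpha beta g : word e h alpha beta g ->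
  exists d, g = a ^+ alpha * (if odd beta then b_conj d
                              else if d then b_conj false * b_conj true else 1).
Proof.
elim=> [|i {}alpha {}beta {}g hi Wg [d IH]|{}alpha {}beta {}g Wg [d IH]].
- by exists false; rewrite expg0 mulg1.
- have conj_ai d' := b_conj_word d' (@word_a _ _ e h i hi).
  exists (if odd beta then d (+) parity i else d).
  have move_right (x y : aut) : x ^ (a ^+ i) = y ->
      a ^+ alpha * x * a ^+ i = a ^+ (alpha + i) * y.
    by move=> <-; rewrite expgnDr -!mulgA -conjgC.
  rewrite IH; apply: move_right; case: ifP => _; first exact: conj_ai.
  case: d {IH}; last exact: conj1g.
  change ((b_conj false * b_conj true) ^ (a ^+ i) = b_conj false * b_conj true).
  by rewrite (conjMg (b_conj _)) !conj_ai; case: (parity i); rewrite //= b_conjC.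
- rewrite IH -mulgA.
  case: (boolP (odd beta)) => ob /=; rewrite ?ob ?(negPf ob) /=.
    exists d; congr (_ * _); case: d {IH}; last by rewrite b_conjF b_square.
    by rewrite b_conjC b_conjF.
  exists d; congr (_ * _); case: d {IH}; last by rewrite mul1g b_conjF.
  rewrite b_conjC b_conjF; apply: etrans (esym (mulgA _ _ _)) _.
  by rewrite b_square mulg1.
Qed.

(* [C l] is the parity of the number of [a ^+ h] in the section at [l] of some
   element of G fixing the first level. *)
Definition realized (C : nat -> bool) : Prop :=
  (forall l, C (l + N)%N = C l) /\
  exists (c : aut) (s : nat -> aut) (A B : nat -> nat),
    [/\ exists alpha beta, word e 1 alpha beta c,
        forall l v, c (lab l :: v) = lab l :: s l v,
        forall l, word e h (A l) (B l) (s l) &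
        forall l, parity (A l) = C l].

Lemma realizedD C C' : realized C -> realized C' -> realized (fun l => C l (+) C' l).
Proof.
move=> [CN [c [s [A [B [[i [j Wc]] cs Ws AC]]]]]].
move=> [CN' [c' [s' [A' [B' [[i' [j' Wc']] cs' Ws' AC']]]]]].
split=> [l|]; first by rewrite CN CN'.
exists (c * c'), (fun l => s l * s' l), (fun l => A l + A' l)%N, (fun l => B l + B' l)%N.
split=> [|l v|l|l].
- by exists (i + i')%N, (j + j')%N; apply: wordM.
- by rewrite fwdM cs cs'.
- exact: wordM.
- by rewrite parityD ?AC ?AC' ?(word_dvd (Ws l)) ?(word_dvd (Ws' l)).
Qed.

(** Conjugation by a power of [a] translates the labels. *)
Lemma realized_shift C : realized C -> realized (fun l => C l.+1).
Proof.
move=> [CN [c [s [A [B [[i [j Wc]] cs Ws AC]]]]]].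
split=> [l|]; first by rewrite -addSn CN.
exists (a * c * a ^+ N.-1), (fun l => s l.+1), (fun l => A l.+1), (fun l => B l.+1).
split=> // [|l v].
  exists (1 + i + N.-1)%N, (0 + j + 0)%N.
  apply: wordM; last exact: word_a.
  by apply: wordM => //; exact: (@word_a _ _ e 1 1).
rewrite !fwdM fwd_a cs fwd_aX; congr (_ :: _).
by apply: lab_mod; rewrite addSnnS prednK // modnDr.
Qed.

Lemma realized_exponent : realized (fun l => parity (E l)).
Proof.
split=> [l|]; first by rewrite exponentD.
exists b, (b_section e), E, (fun l => N %| l : nat)%N; split=> //.
- by exists 0%N, 1%N; exact: (@word_bX _ _ e 1 1).
- exact: fwd_b.
- by move=> l; apply: word_b_section.
Qed.

Lemma realized_false : realized (fun=> false).
Proof.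
split=> //; exists 1, (fun=> 1), (fun=> 0%N), (fun=> 0%N); split=> //.
- by exists 0%N, 0%N; apply: word1.
- by move=> _; apply: word1.
- by move=> _; rewrite /parity div0n.
Qed.

Lemma realized_const d : realized (fun=> d).
Proof.
case: d; last exact: realized_false.
apply: (shift_space_true realizedD realized_shift realized_exponent (n := n)) => [l|].
  by rewrite exponentD.
by have [l El] := E_neq0; exists l; rewrite parity_dvd.
Qed.

Lemma parity_sum L l : parity (\sum_(i <- L) E (l + i)) =
  \big[addb/false]_(i <- L) parity (E (l + i)).
Proof.
suff [] : parity (\sum_(i <- L) E (l + i)) = \big[addb/false]_(i <- L) parity (E (l + i))
          /\ (h %| \sum_(i <- L) E (l + i))%N by [].
elim: L => [|i L [IHL hL]]; first by rewrite !big_nil /parity div0n.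
by rewrite !big_cons parityD // IHL; split=> //; apply: dvdn_add.
Qed.

(* For odd [size L], the pattern is that of [b] up to a coboundary, and coboundaries
   are absorbed by conjugation in G. *)
Lemma parity_coboundary L : exists2 X, realized X & forall l,
  parity (\sum_(i <- L) E (l + i)) = (odd (size L) && parity (E l)) (+) X l (+) X l.+1.
Proof.
have shift i : realized (fun l => parity (E (l + i))).
  elim: i => [|i /realized_shift]; last by under eq_fun do rewrite addSnnS.
  by under eq_fun do rewrite addn0; exact: realized_exponent.
have single i : exists2 X, realized X &
    forall l, parity (E (l + i)) = parity (E l) (+) X l (+) X l.+1.
  elim: i => [|i [X RX HX]].
    by exists (fun=> false) => [|l]; [exact: realized_false | rewrite addn0 !addbF].
  (* Telescoping: the difference of two consecutive shifts of the pattern is the coboundary of the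
     shift by [i]. *)
  exists (fun l => X l (+) parity (E (l + i))) => [|l].
    exact: realizedD.
  rewrite addSnnS.
  by case: (parity (E (l + i))) (parity (E l)) (X l) (X l.+1) (parity (E (l + i.+1)))
    (HX l) => [] [] [] [] [].
elim: L => [|i L [X RX HX]].
  by exists (fun=> false) => [|l]; [exact: realized_false | rewrite big_nil /parity div0n].
have [Y RY HY] := single i; exists (fun l => X l (+) Y l) => [|l]; first exact: realizedD.
rewrite parity_sum big_cons -parity_sum HX HY /=.
by case: (parity _) (odd _) (X l) (X l.+1) (Y l) (Y l.+1) => [] [] [] [] [] [].
Qed.


(** The section patterns of [g] and [g'] differ by the coboundary of a realized [C], and an element
    of G realizing [C], possibly up to a constant, conjugates the chosen powers. *)
Lemma conjugate_powers alpha alpha' beta beta' g g' k :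
  word e 1 alpha beta g -> word e 1 alpha' beta' g' ->
  alpha = 1 %[mod N] -> alpha' = 1 %[mod N] -> odd beta -> odd beta' -> (1 < k)%N ->
  exists M c, [/\ exists i j, word e 1 i j c,
                  eq_level k (g ^+ M * c) (c * g' ^+ M) & ~ eq_level k (g' ^+ M) 1].
Proof.
move=> Wg Wg' a1 a1' ob ob' k_gt1.
have gcd1 x : x = 1 %[mod N] -> gcdn x N = 1%N.
  by move=> x1; rewrite -gcdn_modl x1 gcdn_modl gcd1n.
have [L [s [sL _ gs Ws]]] := word_sections N_gt1 (dvd1n N) (fun l _ => hE l) Wg.
have [L' [s' [sL' _ gs' Ws']]] := word_sections N_gt1 (dvd1n N) (fun l _ => hE l) Wg'.
have [X RX HX] := parity_coboundary L; have [X' RX' HX'] := parity_coboundary L'.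
have RC := realizedD RX RX'; pose C l := X l (+) X' l.
rewrite -/(C) in RC.
set A := fun l => (\sum_(i <- L) E (l + i))%N in Ws HX.
set A' := fun l => (\sum_(i <- L') E (l + i))%N in Ws' HX'.
have {HX HX'}AC l : parity (A' l) = parity (A l) (+) C l (+) C l.+1.
  rewrite HX HX' sL sL' ob ob' /C /=.
  by case: (parity _) (X l) (X l.+1) (X' l) (X' l.+1) => [] [] [] [] [].
have {Ws}Ws l : exists B, word e h (A l) B (s l).
  by have := Ws l; rewrite dvd1n; eexists; eauto.
have {Ws'}Ws' l : exists B, word e h (A' l) B (s' l).
  by have := Ws' l; rewrite dvd1n; eexists; eauto.
have labD x l : x = 1 %[mod N] -> lab (l + x) = lab l.+1.
  by move=> x1; apply: lab_mod; rewrite -(addn1 l) -modnDmr x1 modnDmr.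
have {}gs l v : g (lab l :: v) = lab l.+1 :: s l v by rewrite gs labD.
have {}gs' l v : g' (lab l :: v) = lab l.+1 :: s' l v by rewrite gs' labD.
(* For [k = 2] the exponent is 1: the sections of the [N]-th powers are conjugates of [b], so these
   powers are trivial on level two. *)
case: k k_gt1 => [|[|[|k]]] // _.
  have [_ [c [t [D [B [Wc ct Wt DC]]]]]] := RC.
  exists 1%N, c; rewrite !expg1; split=> //; last first.
    move/(eq_level_le (lab 0) (ltnW (ltnSn 1))).
    move/(eq_level_trans (eq_level_sym (word_level1 N_gt1 Wg')))/eq_level_aX1.
    by move=> /(_ N_gt1 isT); rewrite /dvdn a1' modn_small.
  apply/(eq_level_lab N_gt1) => l v v1; rewrite !fwdM gs ct ct gs'; congr (_ :: _).
  have [Bs Wsl] := Ws l; have [Bs' Wsl'] := Ws' l.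
  have W1 := wordM Wsl (Wt l.+1); have W2 := wordM (Wt l) Wsl'.
  suff : eq_level 1 (s l * t l.+1) (t l * s' l) by apply.
  apply: eq_level_trans (word_level1 N_gt1 W1) _.
  apply: eq_level_trans (eq_level_sym (word_level1 N_gt1 W2)).
  suff -> : a ^+ (A l + D l.+1) = a ^+ (D l + A' l) by [].
  have := word_dvd Wsl; have := word_dvd Wsl'; have := word_dvd (Wt l).
  have := word_dvd (Wt l.+1) => hD hD' hA hA'.
  apply: aX_parity; rewrite ?dvdn_add // !parityD // !DC AC.
  by case: (parity _) (C l) (C l.+1) => [] [] [].
have [H [gH WH]] := power_sections N_gt1 (dvd1n N) (fun l _ => hE l) Wg (gcd1 _ a1).
have [H' [gH' WH']] := power_sections N_gt1 (dvd1n N) (fun l _ => hE l) Wg' (gcd1 _ a1').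
rewrite divn1 in gH gH'.
(* By [NT] the power of [a] in the normal form disappears. *)
have is_conj m f : word e h (m * class_sum e 1 0) m f -> odd m -> exists d, f = b_conj d.
  move=> Wf om; have [d ->] := word_normal Wf; exists d.
  have /dvdnP[q ->] := NT; rewrite om mulnA mulnC expgnA a_order // expg1n.
  exact: mul1g.
(* Conjugation by [f] carries the section of [f ^+ N] at [l] to the one at [l.+1]. *)
have step (f : aut) (u F : nat -> aut) l :
    (forall l v, f (lab l :: v) = lab l.+1 :: u l v) ->
    (forall l v, (f ^+ N) (lab l :: v) = lab l :: F l v) -> F l.+1 = F l ^ u l.
  move=> fu fF; apply: (@mulgI _ (u l)); rewrite -conjgC.
  apply: tree_aut_ext => v; have : (f * f ^+ N) (lab l :: v) = (f ^+ N * f) (lab l :: v).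
    by rewrite -expgS expgSr.
  by rewrite !fwdM fu fF fF fu => -[].
have [d0 H0] := is_conj _ _ (WH 0%N) ob; have [d0' H0'] := is_conj _ _ (WH' 0%N) ob'.
(* The discrepancy at label 0. It is the same at every label, so realizing the constant patterns
   allows [C] to be corrected by it. *)
pose kappa := d0 (+) d0' (+) C 0%N.
have HH' l : exists2 d, H l = b_conj d & H' l = b_conj (d (+) (C l (+) kappa)).
  elim: l => [|l [d Hl Hl']].
    exists d0; rewrite // H0' /kappa; congr b_conj.
    by case: d0 d0' (C 0%N) {H0 H0' kappa} => [] [] [].
  have [B Wsl] := Ws l; have [B' Wsl'] := Ws' l.
  exists (d (+) parity (A l)).
    by rewrite (step _ _ _ _ gs gH) Hl (b_conj_word _ Wsl).
  rewrite (step _ _ _ _ gs' gH') Hl' (b_conj_word _ Wsl') AC; congr b_conj.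
  by case: (parity _) d kappa (C l) (C l.+1) {Hl Hl'} => [] [] [] [] [].
have [_ [c [t [D [B [Wc ct Wt DC]]]]]] := realizedD RC (realized_const kappa).
exists N, c; split=> //.
  suff -> : g ^+ N * c = c * g' ^+ N by [].
  apply: (tree_aut_labP (N_gt1 := N_gt1)) => l v; rewrite !fwdM gH ct ct gH'; congr (_ :: _).
  have [d Hl Hl'] := HH' l.
  suff : H l * t l = t l * H' l by move/(congr1 (fun f : aut => f v)).
  by rewrite Hl' conjgC Hl (b_conj_word _ (Wt l)) DC.
move/(eq_level_lab N_gt1) => g1.
have : eq_level 2 (b_conj d0') 1.
  apply: (@eq_level_le _ (lab 0) 2 k.+2) => // v v_size; rewrite -H0'.
  by have := g1 0%N v v_size; rewrite gH' => -[].
move=> bc1; have [l0] := E_neq0; apply/negP; rewrite negbK.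
rewrite -[E l0]mul1n; apply: (@bX_level2 _ _ N_gt1); rewrite expg1.
rewrite -(conjgK (a ^+ (h * d0')) b) -/(b_conj d0') conjgE invgK.
move: (a ^+ (h * d0')) => y.
have := eq_levelM (eq_levelM (@eq_level_refl _ 2 y) bc1) (@eq_level_refl _ 2 y^-1).
by rewrite mulg1 mulgV mulgA.
Qed.

End ClassEii.

(** * Common conjugate powers in G modulo a level stabiliser *)

Section CommonPowers.
Variables p n : nat.
Hypothesis p_prime : prime p.
Hypothesis N_gt1 : (1 < p ^ n)%N.
Variable e : defining_vector p n.

Local Notation N := (p ^ n)%N.
Local Notation a := (ggs_a p n).
Local Notation b := (ggs_b e).
Local Notation E := (exponent e).
Local Notation lab := (lab N_gt1).

Let N_gt0 : (0 < N)%N. Proof. exact: ltnW. Qed.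

Definition have_common_power k (g g' : tree_aut 'I_N) : Prop :=
  exists M M' c, [/\ exists i j, word e 1 i j c,
    eq_level k (g ^+ M * c) (c * g' ^+ M') & ~ eq_level k (g' ^+ M') 1].

Lemma common_power1 alpha beta g alpha' beta' g' :
  word e 1 alpha beta g -> word e 1 alpha' beta' g' ->
  coprime alpha p -> coprime alpha' p -> have_common_power 1 g g'.
Proof.
move=> Wg Wg' ca ca'; exists alpha', alpha, 1; split.
- by exists 0%N, 0%N; apply: word1.
- rewrite mulg1 mul1g; have := word_level1 N_gt1 (wordX alpha' Wg); rewrite mulnC => W.
  exact: eq_level_trans W (eq_level_sym (word_level1 N_gt1 (wordX alpha Wg'))).
move/(eq_level_trans (eq_level_sym (word_level1 N_gt1 (wordX alpha Wg')))).
move/eq_level_aX1 => /(_ N_gt1 isT).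
rewrite Gauss_dvdr ?coprimeXl 1?coprime_sym // => /gcdn_idPr.
by have /eqP -> : coprime alpha' N; [exact: coprimeXr | move=> N1; move: N_gt1; rewrite -N1].
Qed.

(** Raising [g] to [beta'] and [g'] to [beta] equalises the exponent sums of [b], as [chain_power]
    requires. *)
Lemma common_power_i k alpha beta g alpha' beta' g' :
  (exists l, ~~ (N %| E l)%N) -> chain e 1 -> (1 < k)%N ->
  word e 1 alpha beta g -> word e 1 alpha' beta' g' ->
  coprime alpha N -> coprime alpha' N -> coprime beta N -> coprime beta' N ->
  have_common_power k g g'.
Proof.
move=> E0 ch k_gt1 Wg Wg' ca ca' cb cb'.
have [|M HM] := chain_power N_gt1 E0 ch (ltnW k_gt1); first by rewrite k_gt1 orbT.
have Wb' := wordX beta Wg'; have := wordX beta' Wg; rewrite [(beta' * beta)%N]mulnC => Wb.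
have gcd1 x y : coprime x N -> coprime y N -> gcdn (x * y) N = 1%N.
  by move=> cx cy; apply/eqP; rewrite -/(coprime _ _) coprimeMl cx.
have k_neq1 : k = 1%N -> (beta' * alpha = beta * alpha')%N by move=> k1; rewrite k1 in k_gt1.
have cbb : coprime (beta * beta') N by rewrite coprimeMl cb.
have [gg _] := HM _ _ _ _ _ Wb Wb' (gcd1 _ _ cb' ca) (gcd1 _ _ cb ca') cbb k_neq1.
have [_ g1] := HM _ _ _ _ _ Wb' Wb' (gcd1 _ _ cb ca') (gcd1 _ _ cb ca') cbb (fun=> erefl).
exists (beta' * M)%N, (beta * M)%N, 1; rewrite mulg1 mul1g !expgnA; split=> //.
by exists 0%N, 0%N; apply: word1.
Qed.

Lemma sum_modn (I : Type) (r : seq I) (F G : I -> nat) :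
  (forall i, F i = G i %[mod N]) -> \sum_(i <- r) F i = \sum_(i <- r) G i %[mod N].
Proof.
move=> FG; elim: r => [|i r IHr]; first by rewrite !big_nil.
by rewrite !big_cons -modnDm FG IHr modnDm.
Qed.

(** Compare the first-level sections of [b] and [g] by their action on one letter. *)
Lemma b_level2_word alpha beta g : word e 1 alpha beta g -> eq_level 2 b g ->
  exists2 L, size L = beta & forall l, E l = \sum_(i <- L) E (l + i) %[mod N].
Proof.
move=> Wg bg;
have [L [s [sL _ gs Ws]]] :=
  word_sections N_gt1 (dvd1n N) (fun l _ => dvd1n (E l)) Wg.
exists L => // l; have := Ws l; rewrite dvd1n => Wl.
apply: (@eq_level_aX _ _ N_gt1 1) => //.
apply: eq_level_trans (word_level1 N_gt1 Wl).
apply: eq_level_trans (eq_level_sym (word_level1 N_gt1 (word_b_section (dvd1n (E l))))) _.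
move=> v v1; have /(eq_level_lab N_gt1) b_lab := bg; have := b_lab l v v1.
by rewrite fwd_b gs => -[].
Qed.

(** Summing the congruences over all labels gives S[0] = [beta] S[0] modulo [N]. If [p] divides
    [beta], then [beta - 1] is a unit and S[0] vanishes. *)
Lemma b_not_word_i alpha beta g :
  ~~ (N %| class_sum e 1 0)%N -> word e 1 alpha beta g -> (p %| beta)%N ->
  ~ eq_level 2 b g.
Proof.
move=> NT Wg pb bg; have [L sL HL] := b_level2_word Wg bg.
have TE : class_sum e 1 0 = (\sum_(l < N) E l)%N.
  by rewrite /class_sum divn1; apply: eq_bigr => l _; rewrite add0n mul1n.
have : (class_sum e 1 0 = beta * class_sum e 1 0 %[mod N])%N.
  rewrite {1}TE (sum_modn _ (fun l : 'I_N => HL l)) exchange_big /=.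
  congr (_ %% _)%N; rewrite TE -sL -sum1_size big_distrl /=; apply: eq_bigr => i _.
  by rewrite mul1n (sum_periodic i (exponentD e)).
case: beta pb {Wg sL} => [|beta] pb.
  by rewrite mul0n mod0n => /eqP; apply/negP.
move/eqP; rewrite eq_sym eqn_mod_dvd ?leq_pmull // mulSn addKn Gauss_dvdr ?(negPf NT) //.
rewrite coprime_pexpl; last by move: N_gt1; case: (n); rewrite ?expn0.
rewrite prime_coprime //; apply/negP => pb'.
by move: pb; rewrite -addn1 dvdn_addr // dvdn1 => /eqP p1; move: p_prime; rewrite p1.
Qed.

End CommonPowers.

(** * The same two statements for case (ii) *)

Section CommonPowersEii.
Variable n : nat.
Hypothesis N_gt1 : (1 < 2 ^ n)%N.
Variable e : defining_vector 2 n.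

Local Notation N := (2 ^ n)%N.
Local Notation h := (2 ^ n.-1)%N.
Local Notation b := (ggs_b e).
Local Notation E := (exponent e).

Let N_gt0 : (0 < N)%N. Proof. exact: ltnW. Qed.
Let n_gt0 : (0 < n)%N. Proof. by case: (n) N_gt1. Qed.

Hypothesis E_neq0 : exists l, ~~ (N %| E l).

Lemma class_E_ii_exponents : class_E_ii e ->
  [/\ forall l, (h %| E l)%N, E h = 0%N & (N %| class_sum e 1 0)%N].
Proof.
case=> _ R0 S0 eh; split.
- by move=> l; rewrite -R0; apply: (common_val_dvd N_gt1); rewrite dvd1n.
- rewrite /exponent gtnNdvd ?expn_gt0 ?ltn_exp2l ?prednK //.
  by rewrite modn_small ?ltn_exp2l ?prednK // eh.
- have := dvd_class_sum (isT : prime 2) N_gt1 e (leq0n n) (leqnn n).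
  by rewrite S0 pdvdP // dvdn0 expn0 => <-.
Qed.

Lemma common_power_ii k alpha beta g alpha' beta' g' :
  class_E_ii e -> (1 < k)%N ->
  word e 1 alpha beta g -> word e 1 alpha' beta' g' ->
  odd alpha -> odd alpha' -> odd beta -> odd beta' ->
  have_common_power e k g g'.
Proof.
move=> /class_E_ii_exponents[hE Eh NT] k_gt1.
(* The exponent is an inverse of [i] modulo [N]; it is odd, so the parity of [j] is kept. *)
have norm f i j : word e 1 i j f -> odd i -> odd j ->
    exists m i' j', [/\ word e 1 i' j' (f ^+ m), i' = 1 %[mod N] & odd j'].
  move=> Wf oi oj; have cop : coprime i N by rewrite coprimeXr // coprimen2.
  have /coprimeP[|[u v] /= uv] := cop; first exact: odd_gt0.
  have ui : (u * i = v * N + 1)%N by lia.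
  exists u, (u * i)%N, (u * j)%N; split; first exact: wordX.
    by rewrite ui modnMDl.
  move/(congr1 odd): ui; rewrite oddD !oddM oddX oi oj orbF eqn0Ngt n_gt0.
  by rewrite andbF !andbT.
move=> Wg Wg' oa oa' ob ob'.
have [m [i [j [Wm i1 oj]]]] := norm _ _ _ Wg oa ob.
have [m' [i' [j' [Wm' i1' oj']]]] := norm _ _ _ Wg' oa' ob'.
have [M [c [Wc gc g1]]] := conjugate_powers N_gt1 hE Eh NT E_neq0 Wm Wm' i1 i1' oj oj' k_gt1.
by exists (m * M)%N, (m' * M)%N, c; rewrite !expgnA.
Qed.

(** The patterns equal to the sum of their shifts by [L] form a shift-invariant space containing
    that of [e], hence the constant 1, which forces [size L = beta] to be odd. *)
Lemma b_not_word_ii alpha beta g :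
  class_E_ii e -> word e 1 alpha beta g -> ~~ odd beta -> ~ eq_level 2 b g.
Proof.
move=> /class_E_ii_exponents[hE Eh NT] Wg ob bg.
have [L sL HL] := b_level2_word N_gt1 Wg bg.
pose V (f : nat -> bool) := forall l, f l = \big[addb/false]_(i <- L) f (l + i)%N.
have : V (fun=> true).
  apply: (@shift_space_true V _ _ n (fun l => parity n (E l))).
  - by move=> C C' VC VC' l; rewrite VC VC' -big_split.
  - by move=> C VC l; rewrite VC; apply: eq_bigr => i _; rewrite addSn.
  - move=> l; rewrite -parity_sum // !parity_dvd //; last by apply: dvdn_sum => i _.
    by rewrite /dvdn HL.
  - by move=> l; rewrite exponentD.
  - by have [l El] := E_neq0; exists l; rewrite parity_dvd.
move/(_ 0%N); rewrite big_const_seq count_predT sL => Vt.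
move: ob; suff -> : odd beta by [].
by rewrite /is_true [RHS]Vt; elim: beta {Wg sL Vt} => //= m ->.
Qed.

End CommonPowersEii.

(** * Generating pairs of the level quotients *)

Section LevelQuotient.
Variables p n : nat.
Hypothesis N_gt1 : (1 < p ^ n)%N.
Variables (e : defining_vector p n) (G_fin : finite_set (ggs e)) (k : nat).

Local Notation N := (p ^ n)%N.
Local Notation G := (ggs_type G_fin).
Local Notation S := (ggs_stab_group G_fin k).
Local Notation H := ([set: G] / S)%G.
Local Notation a := (ggs_a p n).
Local Notation b := (ggs_b e).

Lemma mem_ggs_stab (g : G) : (g \in S) <-> eq_level k (val g) 1.
Proof. by rewrite inE; split => [/asboolP|gk]; [|apply/asboolP]. Qed.

Lemma norm_ggs_stab (g : G) : g \in 'N(S).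
Proof.
rewrite inE; apply/fintype.subsetP => _ /imsetP[f /mem_ggs_stab fk ->].
apply/mem_ggs_stab; rewrite conjgE !gmulfM gmulfV.
have := eq_levelM (@eq_level_refl _ k (val g)^-1)
  (eq_levelM fk (@eq_level_refl _ k (val g))).
by rewrite mul1g mulVg.
Qed.

Lemma coset_level (f g : G) :
  coset S f = coset S g <-> eq_level k (val f) (val g).
Proof.
split => [/(rcoset_kercosetP (norm_ggs_stab f) (norm_ggs_stab g))|fg].
  rewrite mem_rcoset => /mem_ggs_stab; rewrite gmulfM gmulfV => fg.
  have := eq_levelM fg (@eq_level_refl _ k (val g)).
  by rewrite mulgVK mul1g.
apply/(rcoset_kercosetP (norm_ggs_stab f) (norm_ggs_stab g)).
rewrite mem_rcoset; apply/mem_ggs_stab; rewrite gmulfM gmulfV.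
have := eq_levelM fg (@eq_level_refl _ k (val g)^-1).
by rewrite mulgV.
Qed.

Lemma cosetM_level (f g : G) : coset S (f * g) = coset S f * coset S g.
Proof. by rewrite morphM ?norm_ggs_stab. Qed.

Lemma cosetX_level (f : G) m : coset S (f ^+ m) = coset S f ^+ m.
Proof. by rewrite morphX ?norm_ggs_stab. Qed.

Lemma coset_surj (z : coset_of S) : exists g : G, z = coset S g.
Proof.
have [g _ <-] : exists2 g, g \in 'N(S) & coset S g = z; last by exists g.
by have [g Ng ->] := cosetP z; exists g.
Qed.

Lemma lift_word (g : G) : exists alpha beta, word e 1 alpha beta (val g).
Proof. by apply: (ggs_word N_gt1); apply/set_mem; exact: (valP g). Qed.

Lemma ggs_lift f : ggs e f -> exists g : G, val g = f.
Proof. by move=> Gf; exists (Sub f (mem_set Gf)); rewrite SubK. Qed.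

(** In a finite group generation needs no inverses, so a multiplicative property of the two
    generators reaches a representative of every coset. *)
Lemma generated_words (P : tree_aut 'I_N -> Prop) (g1 g2 : G) :
  P 1 -> (forall f g, P f -> P g -> P (f * g)) -> P (val g1) -> P (val g2) ->
  <<[set coset S g1; coset S g2]>> = H ->
  forall f, ggs e f -> exists2 f', P f' & eq_level k f f'.
Proof.
move=> P1 PM Pg1 Pg2 genH f /ggs_lift[g <-].
suff [g' Pg' /coset_level gg'] : exists2 g' : G, P (val g') & coset S g = coset S g'.
  by exists (val g').
have : coset S g \in <<[set coset S g1; coset S g2]>>.
  by rewrite genH; apply: mem_quotient; rewrite inE.
case/gen_prodgP => m [c cP ->].
pose Q z := exists2 g' : G, P (val g') & z = coset S g'.
apply: (big_ind Q) => [|x y [g3 P3 ->] [g4 P4 ->]|i _].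
- by exists 1; rewrite ?gmulf1 ?morph1.
- by exists (g3 * g4); rewrite ?gmulfM ?cosetM_level //; exact: PM.
by have /set2P[] := cP i => ->; [exists g1 | exists g2].
Qed.

Lemma mem_Sigma_conj (x y z c : coset_of S) m :
  z \in [set x; y; x * y] -> c \in H -> (z ^+ m) ^ c \in Sigma H x y.
Proof.
move=> zxy Hc; apply/bigcupP; exists c => //.
have memc w : z = w -> z ^+ m ^ c \in <[w]> :^ c.
  by move=> ->; rewrite memJ_conjg mem_cycle.
by move: zxy; rewrite !inE => /orP[/orP[]|] /eqP/memc ->; rewrite ?orbT.
Qed.

Hypothesis p_prime : prime p.
Hypothesis k_gt0 : (0 < k)%N.
(** The input from the two cases; conditions on exponent sums of [b] are imposed only above level
    one, as [b] acts trivially there. *)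
Hypothesis common : forall alpha beta g alpha' beta' g',
  word e 1 alpha beta g -> word e 1 alpha' beta' g' ->
  coprime alpha p -> coprime alpha' p ->
  ((1 < k)%N -> coprime beta p) -> ((1 < k)%N -> coprime beta' p) ->
  have_common_power e k g g'.
Hypothesis b_not_word : (1 < k)%N -> forall alpha beta g,
  word e 1 alpha beta g -> (p %| beta)%N -> ~ eq_level k b g.

Let ncop x : coprime x p = ~~ (p %| x)%N.
Proof. by rewrite coprime_sym prime_coprime. Qed.

(** Neither exponent sum can vanish modulo [p] on both generators, since [a] and, for [1 < k], [b]
    must be reached. If each generator has one sum divisible by [p], these are different sums and
    the product has both prime to [p]. *)
Lemma good_generator x y : <<[set x; y]>> = H ->
  exists (g : G) alpha beta,
    [/\ coset S g \in [set x; y; x * y], word e 1 alpha beta (val g),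
        coprime alpha p & (1 < k)%N -> coprime beta p].
Proof.
have [g1 ->] := coset_surj x; have [g2 ->] := coset_surj y.
move=> genH; have [i1 [j1 W1]] := lift_word g1; have [i2 [j2 W2]] := lift_word g2.
have W12 : word e 1 (i1 + i2) (j1 + j2) (val (g1 * g2)).
  by rewrite gmulfM; apply: wordM.
have x_in : coset S g1 \in [set coset S g1; coset S g2; coset S g1 * coset S g2].
  by rewrite !inE eqxx.
have y_in : coset S g2 \in [set coset S g1; coset S g2; coset S g1 * coset S g2].
  by rewrite !inE eqxx orbT.
have xy_in : coset S (g1 * g2) \in [set coset S g1; coset S g2; coset S g1 * coset S g2].
  by rewrite cosetM_level !inE eqxx orbT.
have word_closed (Q : nat -> nat -> bool) :
    Q 0%N 0%N -> (forall i j i' j', Q i j -> Q i' j' -> Q (i + i')%N (j + j')%N) ->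
    Q i1 j1 -> Q i2 j2 -> forall f, ggs e f ->
    exists f' i j, [/\ word e 1 i j f', Q i j & eq_level k f f'].
  move=> Q0 QD Q1 Q2 f Gf.
  pose P f := exists i j, word e 1 i j f /\ Q i j.
  have [] := @generated_words P g1 g2 _ _ _ _ genH f Gf.
  - by exists 0%N, 0%N; split=> //; apply: word1.
  - move=> f1 f2 [i [j [Wf Qf]]] [i' [j' [Wf' Qf']]].
    by exists (i + i')%N, (j + j')%N; split; [exact: wordM | exact: QD].
  - by exists i1, j1.
  - by exists i2, j2.
  by move=> f' [i [j [Wf Qf]]] ff'; exists f', i, j.
have a_unit : ~~ ((p %| i1) && (p %| i2))%N.
  apply/negP => /andP[pi1 pi2].
  have [|||f [i [j [Wf pi af]]]] := @word_closed (fun i _ => p %| i)%N _ _ pi1 pi2 a.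
  - exact: dvdn0.
  - by move=> ? ? ? ?; apply: dvdn_add.
  - exact: word_ggs (@word_a _ _ e 1 1 _).
  have : eq_level 1 (a ^+ 1) (a ^+ i).
    apply: eq_level_trans (word_level1 N_gt1 Wf).
    by have := eq_level_le (lab N_gt1 0) k_gt0 af; rewrite expg1.
  move/(eq_level_aX N_gt1) => /(_ isT) i1N.
  have n_gt0 : (0 < n)%N by move: N_gt1; case: (n); rewrite ?expn0.
  have pN : (p %| N)%N by rewrite -[X in (X %| _)%N]expn1 dvdn_exp2l.
  move: pi; rewrite /dvdn -(modn_dvdm i pN) -i1N (modn_dvdm 1 pN).
  by rewrite modn_small ?prime_gt1.
have b_unit : (1 < k)%N -> ~~ ((p %| j1) && (p %| j2))%N.
  move=> k_gt1; apply/negP => /andP[pj1 pj2].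
  have [|||f [i [j [Wf pj bf]]]] := @word_closed (fun _ j => p %| j)%N _ _ pj1 pj2 b.
  - exact: dvdn0.
  - by move=> ? ? ? ?; apply: dvdn_add.
  - exact: word_ggs (@word_bX _ _ e 1 1).
  exact: b_not_word k_gt1 _ _ _ Wf pj bf.
have [k_gt1|k_le1] := boolP (1 < k)%N; last first.
  have [pi1|pi1] := boolP (p %| i1)%N.
    by exists g2, i2, j2; split; rewrite ?ncop //; move: a_unit; rewrite pi1.
  by exists g1, i1, j1; split; rewrite ?ncop.
have [pi1|pi1] := boolP (p %| i1)%N.
  have pi2 : ~~ (p %| i2)%N by move: a_unit; rewrite pi1.
  have [pj2|pj2] := boolP (p %| j2)%N; last by exists g2, i2, j2; split; rewrite ?ncop.
  exists (g1 * g2), (i1 + i2)%N, (j1 + j2)%N; split=> // [|_]; rewrite ncop.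
    by rewrite dvdn_addr.
  by rewrite dvdn_addl //; have := b_unit k_gt1; rewrite pj2 andbT.
have [pj1|pj1] := boolP (p %| j1)%N; last by exists g1, i1, j1; split; rewrite ?ncop.
have pj2 : ~~ (p %| j2)%N by have := b_unit k_gt1; rewrite pj1.
have [pi2|pi2] := boolP (p %| i2)%N; last by exists g2, i2, j2; split; rewrite ?ncop.
exists (g1 * g2), (i1 + i2)%N, (j1 + j2)%N; split=> // [|_]; rewrite ncop.
  by rewrite dvdn_addl.
by rewrite dvdn_addr.
Qed.

Lemma not_Beauville : ~ Beauville H.
Proof.
case=> _ [x1 [y1 [x2 [y2 [gen1 gen2 trivial_cap]]]]].
have [g1 [i1 [j1 [in1 W1 ci1 cj1]]]] := good_generator gen1.
have [g2 [i2 [j2 [in2 W2 ci2 cj2]]]] := good_generator gen2.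
have [M [M' [f [[i [j Wf]] gf g2_neq1]]]] := common W1 W2 ci1 ci2 cj1 cj2.
have [c cE] := ggs_lift (word_ggs Wf); subst f.
have E : (coset S g1 ^+ M) ^ coset S c = coset S g2 ^+ M'.
  apply: (@mulgI _ (coset S c)); rewrite -conjgC -!cosetX_level -!cosetM_level.
  by apply/coset_level; rewrite !gmulfM !gmulfXn.
apply: g2_neq1; suff /coset_level : coset S (g2 ^+ M') = coset S 1.
  by rewrite gmulfXn gmulf1.
rewrite cosetX_level morph1; apply/set1P.
rewrite -[[set 1]]/(1 : {set coset_of S}) -trivial_cap inE.
rewrite -{1}E (mem_Sigma_conj _ in1) ?mem_quotient ?inE //=.
by rewrite -[_ ^+ _]conjg1 (mem_Sigma_conj _ in2) ?group1.
Qed.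

End LevelQuotient.

(** * Level quotients of the groups in the class E *)

Theorem theorem1p2 (p n : nat) (p_prime : prime p) (n_ge2 : (2 <= n)%N)
    (e : defining_vector p n) (e_neq0 : e != 0%R)
    (G_fin : finite_set (ggs e)) (G_in_E : class_E e)
    (k : nat) (k_ge1 : (1 <= k)%N) :
  ~ Beauville ([set: ggs_type G_fin] / ggs_stab G_fin k)%G.
Proof.
have n_gt0 : (0 < n)%N by exact: ltnW.
have N_gt1 : (1 < p ^ n)%N by rewrite -(expn0 p) ltn_exp2l ?prime_gt1.
have E_neq0 : exists l, ~~ (p ^ n %| exponent e l)%N.
  (* Coordinates are numbered from 0 and labels from 1. *)
  have [i ei] := rV0Pn _ e_neq0; exists i.+1.
  have iN : (i.+1 < p ^ n)%N by rewrite -ltn_predRL.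
  rewrite /exponent gtnNdvd // modn_small // /entry /= valK gtnNdvd ?lt0n //.
  by apply: leq_trans (ltn_ord (e ord0 i)) _; rewrite Zp_cast.
have copX x : coprime x p -> coprime x (p ^ n) by exact: coprimeXr.
apply: not_Beauville => //.
- move=> alpha beta g alpha' beta' g' W W' ca ca' cb cb'.
  case: k k_ge1 cb cb' => [|[|k]] // _ cb cb'; first exact: common_power1 W W' ca ca'.
  case: G_in_E => [Ei|Eii].
    have [ch _] := class_E_i_chain p_prime N_gt1 E_neq0 Ei.
    by apply: (common_power_i N_gt1 E_neq0 ch _ W W'); rewrite ?copX ?cb ?cb'.
  have p2 : p = 2%N by case: Eii.
  subst p; apply: (common_power_ii N_gt1 E_neq0 Eii _ W W'); rewrite // -coprimen2 ?cb ?cb' //.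
- move=> k_gt1 alpha beta g W pb /(eq_level_le (lab N_gt1 0) k_gt1).
  case: G_in_E => [Ei|Eii].
    have [_ NT] := class_E_i_chain p_prime N_gt1 E_neq0 Ei.
    exact: b_not_word_i p_prime N_gt1 _ _ _ _ NT W pb.
  have p2 : p = 2%N by case: Eii.
  subst p; apply: (b_not_word_ii N_gt1 E_neq0 Eii W).
  by move: pb; rewrite dvdn2.
Qed.
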